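(* Let $P$ be a $d$-dimensional Gorenstein polytope of index $r$ with $r > \frac{d+2}{2}$. Then $P$ is isomorphic to a free join of (at least two, nonempty) Gorenstein polytopes.
   Context: Let $M\cong\mathbb{Z}^d$ be a lattice with associated real vector space $M_{\mathbb{R}}=M\otimes\mathbb{R}$. A lattice polytope is a nonempty polytope in $M_{\mathbb R}$ with vertices in $M$; it is always considered with respect to the lattice of its affine hull (lattice points of $M$ in the affine hull). Two lattice polytopes are isomorphic if there is an affine isomorphism of their affine hulls mapping one polytope onto the other and mapping the lattices bijectively onto each other. A lattice polytope $P$ is reflexive if it contains a (relative) interior lattice point $m$ having lattice distance one from every facet, i.e. for each facet $F$ there is an integral functional $u$ in the dual lattice with $\langle u,f\rangle-\langle u,m\rangle=1$ for all $f\in F$. A lattice polytope $P$ is Gorenstein if there is a positive integer $r$ such that $rP$ is reflexive; $r$ is then unique and called the index of $P$. Given lattice polytopes $P_1,P_2$ with respect to lattices $M_1,M_2$, their free join is $$P_1\circ_{\mathbb Z}P_2:=\operatorname{conv}\bigl(P_1\times\{0\}\times\{0\},\ \{0\}\times P_2\times\{1\}\bigr)\subset (M_1)_{\mathbb R}\oplus (M_2)_{\mathbb R}\oplus\mathbb R,$$ with respect to the lattice $M_1\oplus M_2\oplus\mathbb Z$ (here $P_i$ is taken full-dimensional in $(M_i)_{\mathbb R}$). Free joins of several polytopes are obtained by iterating. *)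

(* Defs.v *)
From HB Require Import structures.
From mathcomp Require Import all_boot all_order all_algebra.
From mathcomp Require Import boolp classical_sets functions cardinality.
From mathcomp Require Import reals topology normedtype.

Set Implicit Arguments.
Unset Strict Implicit.
Unset Printing Implicit Defensive.

Import Order.TTheory GRing.Theory Num.Theory.
Import numFieldNormedType.Exports.

Local Open Scope classical_set_scope.
Local Open Scope ring_scope.

(* The lattice M is Z^n, sitting in M_R = R^n as the integral row vectors.  A
   polytope need not be full-dimensional: every lattice-theoretic notion below
   refers to the lattice points of its affine hull. *)

Definition conv_hull (R : realType) (n : nat) (A : set 'rV[R]_n) :
    set 'rV[R]_n :=
  [set x | exists (k : nat) (c : 'I_k -> R) (p : 'I_k -> 'rV[R]_n),
     [/\ forall i, A (p i), forall i, 0 <= c i, \sum_i c i = 1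
       & x = \sum_i c i *: p i]].

Definition aff_hull (R : realType) (n : nat) (A : set 'rV[R]_n) :
    set 'rV[R]_n :=
  [set x | exists (k : nat) (c : 'I_k -> R) (p : 'I_k -> 'rV[R]_n),
     [/\ forall i, A (p i), \sum_i c i = 1 & x = \sum_i c i *: p i]].

(* The affine hull of A is a translate of a d-dimensional linear subspace; in
   particular A is nonempty. *)
Definition has_dim (R : realType) (n : nat) (A : set 'rV[R]_n) (d : nat) :
    Prop :=
  exists (x0 : 'rV[R]_n) (U : {vspace 'rV[R]_n}),
    \dim U = d /\ aff_hull A = [set x | x - x0 \in U].

Definition pairing (R : realType) (n : nat) (u : 'cV[R]_n) (x : 'rV[R]_n) : R :=
  (x *m u) 0 0.

(* Both the empty set and P itself count as faces of P. *)
Definition face (R : realType) (n : nat) (P F : set 'rV[R]_n) : Prop :=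
  exists (u : 'cV[R]_n) (b : R),
    (forall x, P x -> pairing u x <= b) /\
    F = P `&` [set x | pairing u x = b].

Definition vertex (R : realType) (n : nat) (P : set 'rV[R]_n)
    (v : 'rV[R]_n) : Prop :=
  face P [set v].

(* A point has no facets, since has_dim never holds of the empty set. *)
Definition facet (R : realType) (n : nat) (P F : set 'rV[R]_n) : Prop :=
  face P F /\ exists d : nat, has_dim P d.+1 /\ has_dim F d.

Definition rel_interior (R : realType) (n : nat) (P : set 'rV[R]_n) :
    set 'rV[R]_n :=
  [set m | P m /\ \forall x \near m, aff_hull P x -> P x].

Definition aff_lattice (R : realType) (n : nat) (P : set 'rV[R]_n) :
    set 'rV[R]_n :=
  aff_hull P `&` [set x | x \is a mxOver Num.int].

Definition polytope (R : realType) (n : nat) (P : set 'rV[R]_n) : Prop :=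
  exists2 V : set 'rV[R]_n, finite_set V & P = conv_hull V.

Definition lattice_polytope (R : realType) (n : nat) (P : set 'rV[R]_n) :
    Prop :=
  [/\ polytope P, P !=set0
    & forall v, vertex P v -> v \is a mxOver Num.int].

(* The restriction of u to the direction space of aff P lies in the dual of the
   lattice of that space. *)
Definition integral_functional (R : realType) (n : nat) (P : set 'rV[R]_n)
    (u : 'cV[R]_n) : Prop :=
  forall x y, aff_lattice P x -> aff_lattice P y ->
    pairing u (x - y) \is a Num.int.

Definition reflexive_polytope (R : realType) (n : nat) (P : set 'rV[R]_n) :
    Prop :=
  lattice_polytope P /\
  exists m, [/\ rel_interior P m, m \is a mxOver Num.int
    & forall F, facet P F ->
        exists u, integral_functional P u /\
          forall f, F f -> pairing u f - pairing u m = 1].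

Definition dilate (R : realType) (n : nat) (r : nat) (P : set 'rV[R]_n) :
    set 'rV[R]_n :=
  [set r%:R *: x | x in P].

Definition gorenstein (R : realType) (n : nat) (P : set 'rV[R]_n) : Prop :=
  lattice_polytope P /\
  exists r : nat, (0 < r)%N /\ reflexive_polytope (dilate r P).

(* In positive dimension there is exactly one r > 0 with rP reflexive, so the
   minimality clause is redundant.  All dilates of a lattice point are
   (vacuously) reflexive, and minimality gives a point its usual index 1. *)
Definition gorenstein_index (R : realType) (n : nat) (P : set 'rV[R]_n)
    (r : nat) : Prop :=
  [/\ (0 < r)%N, reflexive_polytope (dilate r P)
    & forall s : nat, (0 < s)%N -> reflexive_polytope (dilate s P) ->
        (r <= s)%N].

Definition lattice_isomorphic (R : realType) (m n : nat)
    (P : set 'rV[R]_m) (Q : set 'rV[R]_n) : Prop :=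
  exists f : 'rV[R]_m -> 'rV[R]_n,
    [/\ forall (x y : 'rV[R]_m) (t : R), aff_hull P x -> aff_hull P y ->
          f (t *: x + (1 - t) *: y) = t *: f x + (1 - t) *: f y,
        set_bij (aff_hull P) (aff_hull Q) f,
        f @` P = Q
      & f @` aff_lattice P = aff_lattice Q].

Definition free_join (R : realType) (m n : nat)
    (P : set 'rV[R]_m) (Q : set 'rV[R]_n) : set 'rV[R]_(m + n + 1) :=
  conv_hull ([set row_mx (row_mx x 0) 0 | x in P] `|`
             [set row_mx (row_mx 0 y) (const_mx 1) | y in Q]).

Fixpoint free_join_rank (n : nat -> nat) (k : nat) : nat :=
  if k is k'.+1 then (free_join_rank n k' + n k'.+1 + 1)%N else n 0%N.

(* Q 0, Q 1, ..., Q k joined from left to right: k + 1 polytopes in total. *)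
Fixpoint iter_free_join (R : realType) (n : nat -> nat)
    (Q : forall i : nat, set 'rV[R]_(n i)) (k : nat) :
    set 'rV[R]_(free_join_rank n k) :=
  match k return set 'rV[R]_(free_join_rank n k) with
  | 0%N => Q 0%N
  | k'.+1 => free_join (@iter_free_join R n Q k') (Q k'.+1)
  end.
Arguments iter_free_join {R n} Q k _.

(* Main.v *)
Require Import Defs.
From HB Require Import structures.
From mathcomp Require Import all_boot all_order all_algebra.
From mathcomp Require Import boolp classical_sets functions cardinality.
From mathcomp Require Import reals topology normedtype.
From mathcomp Require Import ring lra zify.

(* Work in the cone over P x {1}, with rays x_i through the vertices and facet
   functionals y_j.  Reflexivity of rP gives a lattice point m at height r with
   y_j(m) = 1 for all j, and the height h satisfies h(x_i) = 1 for all i.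
   Write h as a positive combination of linearly independent y_j, j in J.  The
   coefficients are at most 1, since an integral functional that is positive on
   all x_i is at least r at m, while h - y_j has value r - 1 there.  Let J1 be the
   set of indices with coefficient 1; the same bound for the sum of the y_j over J
   and over J1 minus h gives |J| + |J1| >= 2r.  The sets A_j = {i : y_j(x_i) = 1},
   j in J1, are disjoint, and the differences inside the A_j span a space of
   dimension at most d + 1 - |J| <= |J1| - 2.
   Take S in J1 minimal such that the differences inside the A_j, j in S, span
   fewer than |S| dimensions.  By Rado's theorem and a perturbation argument every
   coset of the lattice spanned by the x_i meets the relative interior of the
   Minkowski sum of the conv A_j, j in S.  A lattice point v in this interior has
   height |S|; counting the weights of the facets that do not vanish at v shows that
   these facets vanish on all other vertices, so the cone is a direct sum.  The
   same interior point in other cosets shows that the lattice splits as well. *)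

Set Implicit Arguments.
Unset Strict Implicit.
Unset Printing Implicit Defensive.

Import Order.TTheory GRing.Theory Num.Theory.
Import numFieldNormedType.Exports.

Local Open Scope ring_scope.

(** * Linear algebra *)

(** In the code the sets A_j are colours. The bound on r is spent on the 2 in |J1| - 2: one unit
    makes J1 deficient (its differences span fewer than |J1| dimensions), so a minimal S exists; the
    other forces S to be a proper subset of J1, because J1 minus one colour is still deficient. A
    colour outside S supplies a vertex for the second factor. Minimality is used twice more. It is
    Rado's condition on S minus one colour, giving one edge per remaining colour, and these edges
    form a basis of the span of all differences. It also provides, for each smaller set of colours,
    a difference leaving the span of the edges used so far, which is the room for the perturbation.
    The obstacle is the lattice: the vertices need not generate it, so splitting the cone says
    nothing about lattice points. Hence the interior point is needed in every coset. For a lattice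
    point g with component g1 on the S side, the interior point congruent to g1 is still integral on
    the facets of that side; the weight count then makes it the unique point where they all equal 1,
    so g1 is integral. P need not be full-dimensional, so functionals count only through their
    values on the span of the x_i. *)

Lemma pairingD (R : realType) (n : nat) (u : 'cV[R]_n) (x y : 'rV[R]_n) :
  pairing u (x + y) = pairing u x + pairing u y.
Proof. by rewrite /pairing mulmxDl mxE. Qed.

Lemma pairingZ (R : realType) (n : nat) (u : 'cV[R]_n) (a : R) (x : 'rV[R]_n) :
  pairing u (a *: x) = a * pairing u x.
Proof. by rewrite /pairing -scalemxAl mxE. Qed.

Lemma pairing0 (R : realType) (n : nat) (u : 'cV[R]_n) : pairing u 0 = 0.
Proof. by rewrite /pairing mul0mx mxE. Qed.

Lemma pairingB (R : realType) (n : nat) (u : 'cV[R]_n) (x y : 'rV[R]_n) :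
  pairing u (x - y) = pairing u x - pairing u y.
Proof. by rewrite -scaleN1r pairingD pairingZ mulN1r. Qed.

Lemma pairing_sumZ (R : realType) (n : nat) (u : 'cV[R]_n) (I : finType)
    (A : pred I) (c : I -> R) (x : I -> 'rV[R]_n) :
  pairing u (\sum_(i | A i) c i *: x i) = \sum_(i | A i) c i * pairing u (x i).
Proof.
rewrite (big_morph (pairing u) (pairingD u) (pairing0 u)).
by under eq_bigr do rewrite pairingZ.
Qed.

Lemma pairingDl (R : realType) (n : nat) (u v : 'cV[R]_n) (x : 'rV[R]_n) :
  pairing (u + v) x = pairing u x + pairing v x.
Proof. by rewrite /pairing mulmxDr mxE. Qed.

Lemma pairingZl (R : realType) (n : nat) (a : R) (u : 'cV[R]_n) (x : 'rV[R]_n) :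
  pairing (a *: u) x = a * pairing u x.
Proof. by rewrite /pairing -scalemxAr mxE. Qed.

Lemma pairing0l (R : realType) (n : nat) (x : 'rV[R]_n) : pairing 0 x = 0.
Proof. by rewrite /pairing mulmx0 mxE. Qed.

Lemma pairingBl (R : realType) (n : nat) (u v : 'cV[R]_n) (x : 'rV[R]_n) :
  pairing (u - v) x = pairing u x - pairing v x.
Proof. by rewrite -scaleN1r pairingDl pairingZl mulN1r. Qed.

Lemma pairing_sumZl (R : realType) (n : nat) (x : 'rV[R]_n) (I : finType)
    (A : pred I) (c : I -> R) (u : I -> 'cV[R]_n) :
  pairing (\sum_(i | A i) c i *: u i) x = \sum_(i | A i) c i * pairing (u i) x.
Proof.
rewrite (big_morph (fun u => pairing u x) (fun u v => pairingDl u v x)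
  (pairing0l x)).
by under eq_bigr do rewrite pairingZl.
Qed.

Lemma pairing_mulmx (R : realType) (m n : nat) (M : 'M[R]_(m, n))
    (u : 'cV[R]_n) (x : 'rV[R]_m) :
  pairing u (x *m M) = pairing (M *m u) x.
Proof. by rewrite /pairing mulmxA. Qed.

Lemma sum_deltaZ (R : nzRingType) (V : lmodType R) (I : finType) (k : I)
    (x : I -> V) :
  \sum_i (i == k)%:R *: x i = x k.
Proof.
rewrite (bigD1 k) //= eqxx scale1r big1 ?addr0 // => i /negbTE ->.
by rewrite scale0r.
Qed.

(** * Spans of finite families and independent transversals *)

Definition rowspan (F : fieldType) (n : nat) (I : finType) (A : pred I)
    (x : I -> 'rV[F]_n) : 'M[F]_n :=
  (\sum_(i | A i) <<x i>>)%MS.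

Lemma rowspanP (F : fieldType) (n : nat) (I : finType) (A : pred I)
    (x : I -> 'rV[F]_n) (v : 'rV[F]_n) :
  reflect (exists c : I -> F, v = \sum_(i | A i) c i *: x i) (v <= rowspan A x)%MS.
Proof.
apply: (iffP idP) => [/sub_sumsmxP [u ->]|[c ->]]; last first.
  apply: summx_sub => i Ai; apply: scalemx_sub; apply: (sumsmx_sup i) => //.
  by rewrite genmxE.
have /choice [c hc] : forall i, exists c : F, u i *m <<x i>>%MS = c *: x i.
  move=> i; have : (u i *m <<x i>>%MS <= x i)%MS.
    by apply: submx_trans (submxMl _ _) _; rewrite genmxE.
  by move=> /sub_rVP [c ->]; exists c.
by exists c; apply: eq_bigr => i _; rewrite hc.
Qed.

Lemma rowspan_sup (F : fieldType) (n : nat) (I : finType) (A : pred I)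
    (x : I -> 'rV[F]_n) (i : I) : A i -> (x i <= rowspan A x)%MS.
Proof. by move=> Ai; apply: (sumsmx_sup i) => //; rewrite genmxE. Qed.

Lemma rowspan_subP (F : fieldType) (n k : nat) (I : finType) (A : pred I)
    (x : I -> 'rV[F]_n) (W : 'M[F]_(k, n)) :
  (forall i, A i -> (x i <= W)%MS) -> (rowspan A x <= W)%MS.
Proof. by move=> h; apply/sumsmx_subP => i Ai; rewrite genmxE h. Qed.

Lemma rank_rowspan_le (F : fieldType) (n : nat) (I : finType) (A : {set I})
    (x : I -> 'rV[F]_n) : (\rank (rowspan [in A] x) <= #|A|)%N.
Proof.
rewrite -sum1_card /rowspan.
apply: (@big_ind2 _ _ (fun (U : 'M[F]_n) k => (\rank U <= k)%N)) => [|U k V l hU hV|i _].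
- by rewrite mxrank0.
- apply: leq_trans (leq_of_leqif (mxrank_adds_leqif _ _)) _.
  exact: leq_add.
- by rewrite genmxE rank_leq_row.
Qed.

Lemma rowspan_setU (F : fieldType) (n : nat) (I : finType) (A B : {set I})
    (x : I -> 'rV[F]_n) :
  (rowspan [in A :|: B] x :=: rowspan [in A] x + rowspan [in B] x)%MS.
Proof.
apply/eqmxP; apply/andP; split.
  apply: rowspan_subP => i /=; rewrite inE => /orP[] iA.
    by apply: submx_trans (addsmxSl _ _); apply: rowspan_sup.
  by apply: submx_trans (addsmxSr _ _); apply: rowspan_sup.
rewrite addsmx_sub; apply/andP; split; apply: rowspan_subP => i /= iA.
  by rewrite (@rowspan_sup _ _ _ _ x) //= inE iA.
by rewrite (@rowspan_sup _ _ _ _ x) //= inE iA orbT.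
Qed.

Lemma eq_rowspan (F : fieldType) (n : nat) (I : finType) (A B : pred I)
    (x z : I -> 'rV[F]_n) :
  A =1 B -> (forall i, A i -> x i = z i) -> rowspan A x = rowspan B z.
Proof. by move=> AB xz; apply: eq_big => // i Ai; rewrite xz. Qed.

Lemma sum_rowspan_setU (F : fieldType) (n : nat) (I J : finType)
    (P : J -> pred I) (e : J -> I -> 'rV[F]_n) (A B : {set J}) :
  (\sum_(j in A :|: B) rowspan (P j) (e j) :=:
   \sum_(j in A) rowspan (P j) (e j) + \sum_(j in B) rowspan (P j) (e j))%MS.
Proof.
apply/eqmxP; apply/andP; split.
  apply/sumsmx_subP => i; rewrite inE => /orP[] iA.
    by apply: submx_trans (addsmxSl _ _); apply: sumsmx_sup iA _.
  by apply: submx_trans (addsmxSr _ _); apply: sumsmx_sup iA _.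
rewrite addsmx_sub; apply/andP; split; apply/sumsmx_subP => i iA;
  by apply: (sumsmx_sup i) => //; rewrite inE iA ?orbT.
Qed.

(* Rado's theorem on independent transversals, relative to a subspace W. *)
Lemma independent_transversal (F : fieldType) (n : nat) (I J : finType)
    (P : J -> pred I) (e : J -> I -> 'rV[F]_n) (f0 : J -> I)
    (T : {set J}) (W : 'M[F]_n) :
  (forall U : {set J}, U \subset T ->
    (#|U| + \rank W <= \rank (W + \sum_(j in U) rowspan (P j) (e j))%MS)%N) ->
  exists f : J -> I, (forall j, j \in T -> P j (f j)) /\
    \rank (W + rowspan [in T] (fun j => e j (f j)))%MS = (#|T| + \rank W)%N.
Proof.
elim: {T}_.+1 {-2}T (ltnSn #|T|) W => // k IH T leT W hall.
have [->|[t tT]] := set_0Vmem T.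
  exists f0; split=> [j|]; first by rewrite inE.
  by rewrite cards0 add0n /rowspan big_pred0 ?addsmx0 // => j; rewrite inE.
(* A tight [U] splits the problem: a transversal of [U] spans, together with [W], all that [U] can
   reach, and modulo this space the rank condition persists for the rest of [T]. *)
have [/existsP[U /and4P[UT U0 UnT /eqP rU]]|notight] :=
  boolP [exists U : {set J}, [&& U \subset T, U != finset.set0, U != T &
    \rank (W + \sum_(j in U) rowspan (P j) (e j))%MS == (#|U| + \rank W)%N]].
  have TE : T = U :|: T :\: U.
    apply/setP => j; rewrite !inE.
    by case: (boolP (j \in U)) => // /(fintype.subsetP UT).
  have disj (V : {set J}) : V \subset T :\: U -> V :&: U = finset.set0.
    move=> VT; apply/setP => j; rewrite !inE; apply/negP => /andP[jV jU].
    by have := fintype.subsetP VT j jV; rewrite inE jU.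
  have cT : #|T| = (#|U| + #|T :\: U|)%N.
    by rewrite [in LHS]TE cardsU finset.setIC disj // cards0 subn0.
  have U_gt0 : (0 < #|U|)%N by rewrite card_gt0.
  have TU_gt0 : (0 < #|T :\: U|)%N.
    rewrite card_gt0; apply: contra UnT => /eqP TU0.
    by rewrite TE TU0 finset.setU0.
  have [||f1 [Pf1 rf1]] := IH U _ W.
  - by move: leT; rewrite cT; lia.
  - by move=> V VU; apply: hall; apply: fintype.subset_trans UT.
  pose W1 := (W + \sum_(j in U) rowspan (P j) (e j))%MS.
  have [||f2 [Pf2 rf2]] := IH (T :\: U) _ W1.
  - by move: leT; rewrite cT; lia.
  - move=> V VT; rewrite /W1 rU addnA.
    have <- : #|V :|: U| = (#|V| + #|U|)%N.
      by rewrite cardsU disj // cards0 subn0.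
    apply: leq_trans (hall _ _) _.
      rewrite finset.subUset UT andbT; apply: fintype.subset_trans VT _.
      exact: finset.subsetDl.
    apply: mxrankS; rewrite addsmx_sub; apply/andP; split.
      by apply: submx_trans (addsmxSl _ _); apply: addsmxSl.
    rewrite sum_rowspan_setU addsmx_sub addsmxSr /=.
    by apply: submx_trans (addsmxSl _ _); apply: addsmxSr.
  exists (fun j => if j \in U then f1 j else f2 j); split=> [j jT|].
    by case: ifPn => jU; [exact: Pf1|apply: Pf2; rewrite inE jU].
  rewrite cT -addnA [(#|_ :\: _| + _)%N]addnC addnA -rU addnC -rf2.
  have W1E : (W1 :=: W + rowspan [in U] (fun j => e j (f1 j)))%MS.
    apply/eqmx_sym/eqmxP; rewrite -mxrank_leqif_eq.
      by rewrite /W1 rU rf1.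
    apply: addsmxS => //; apply: rowspan_subP => j /= jU.
    by apply: (sumsmx_sup j) => //; apply: rowspan_sup; exact: Pf1.
  have spE (A : {set J}) g h : (forall j, j \in A -> g j = h j) ->
      rowspan [in A] (fun j => e j (g j)) = rowspan [in A] (fun j => e j (h j)).
    by move=> gh; apply: eq_rowspan => // j /= jA; rewrite gh.
  rewrite {1}TE (adds_eqmx (eqmx_refl W) (rowspan_setU _ _ _)) 
    (spE U _ f1); last by move=> j ->.
  rewrite (spE (T :\: U) _ f2); last by move=> j; rewrite inE => /andP[/negbTE ->].
  by rewrite addsmxA (adds_eqmx W1E (eqmx_refl _)).
(* Without tight sets every nonempty proper [U] has a dimension to spare, so any vector for [t]
   outside [W] may be chosen and absorbed into [W]. *)
have gt_span (U : {set J}) : U \subset T -> U != finset.set0 -> U != T ->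
    (#|U| + \rank W < \rank (W + \sum_(j in U) rowspan (P j) (e j))%MS)%N.
  move=> UT U0 UnT; rewrite ltn_neqAle hall // andbT.
  apply: contra notight => /eqP rE; apply/existsP; exists U.
  by rewrite UT U0 UnT -rE eqxx.
have [i Pi niW] : exists2 i, P t i & ~~ (e t i <= W)%MS.
  apply: contrapT => no.
  have := hall [set t]; rewrite finset.sub1set tT cards1 big_set1.
  move=> /(_ isT); apply/negP; rewrite -ltnNge ltnS; apply: mxrankS.
  rewrite addsmx_sub submx_refl; apply: rowspan_subP => i Pi.
  by apply: contrapT => /negP niW; apply: no; exists i.
pose W1 := (W + <<e t i>>)%MS.
have rW1 : \rank W1 = (\rank W).+1.
  apply/eqP; rewrite eqn_leq rank_ltmx ?andbT; last first.
    rewrite ltmxE addsmxSl; apply: contra niW => /(submx_trans _); apply.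
    by apply: submx_trans (addsmxSr _ _); rewrite genmxE.
  apply: leq_trans (leq_of_leqif (mxrank_adds_leqif _ _)) _.
  by rewrite -[(\rank W).+1]addn1 leq_add2l genmxE rank_leq_row.
have cT : #|T| = #|T :\ t|.+1 by rewrite (cardsD1 t) tT.
have [||f [Pf rf]] := IH (T :\ t) _ W1.
- by move: leT; rewrite cT; lia.
- move=> U UT; have [->|U0] := eqVneq U finset.set0.
    by rewrite cards0 add0n mxrankS // addsmxSl.
  rewrite rW1 addnS; apply: leq_trans (gt_span U _ U0 _) _.
  + exact: fintype.subset_trans UT (finset.subD1set _ _).
  + apply: contraTneq UT => ->; apply/negP => /fintype.subsetP /(_ t tT).
    by rewrite !inE eqxx.
  + by apply: mxrankS; apply: addsmxS => //; exact: addsmxSl.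
exists (fun j => if j == t then i else f j); split=> [j jT|].
  by case: eqP => [->//|/eqP jt]; apply: Pf; rewrite !inE jt.
rewrite cT addSnnS -rW1 -rf -{1}(finset.setD1K tT) /W1.
rewrite (adds_eqmx (eqmx_refl W) (rowspan_setU _ _ _)) addsmxA.
congr (\rank (_ + _ + _)%MS); first by rewrite /rowspan big_set1 eqxx.
by apply: eq_rowspan => // j /=; rewrite !inE => /andP[/negbTE ->].
Qed.

(** * Integral matrices *)

Lemma int_mxD (R : realType) (m n : nat) (A B : 'M[R]_(m, n)) :
  A \is a mxOver Num.int -> B \is a mxOver Num.int ->
  A + B \is a mxOver Num.int.
Proof.
by move=> /mxOverP AI /mxOverP BI; apply/mxOverP => i j; rewrite mxE rpredD.
Qed.

Lemma int_mxB (R : realType) (m n : nat) (A B : 'M[R]_(m, n)) :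
  A \is a mxOver Num.int -> B \is a mxOver Num.int ->
  A - B \is a mxOver Num.int.
Proof.
by move=> /mxOverP AI /mxOverP BI; apply/mxOverP => i j; rewrite !mxE rpredB.
Qed.

Lemma int_mxZ (R : realType) (m n : nat) (a : R) (A : 'M[R]_(m, n)) :
  a \is a Num.int -> A \is a mxOver Num.int -> a *: A \is a mxOver Num.int.
Proof.
by move=> aI /mxOverP AI; apply/mxOverP => i j; rewrite mxE rpredM.
Qed.

Lemma int_mxM (R : realType) (m n p : nat) (A : 'M[R]_(m, n)) (B : 'M[R]_(n, p)) :
  A \is a mxOver Num.int -> B \is a mxOver Num.int ->
  A *m B \is a mxOver Num.int.
Proof.
move=> /mxOverP AI /mxOverP BI; apply/mxOverP => i j.
by rewrite mxE rpred_sum // => k _; rewrite rpredM.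
Qed.

Lemma int_mx_sum (R : realType) (m n : nat) (I : finType) (P : pred I)
    (A : I -> 'M[R]_(m, n)) :
  (forall i, P i -> A i \is a mxOver Num.int) ->
  \sum_(i | P i) A i \is a mxOver Num.int.
Proof.
move=> AI; apply/mxOverP => i j; rewrite summxE rpred_sum // => k /AI.
by move=> /mxOverP.
Qed.

(** * Lattice points in Minkowski sums *)

Lemma pos_lower_bound (R : realFieldType) (I : finType) (f : I -> R) :
  (forall i, 0 < f i) -> exists2 e, 0 < e & forall i, e <= f i.
Proof.
move=> f_gt0; exists (\big[Num.min/1]_i f i); last by move=> i; exact: bigmin_le.
by apply: lt_bigmin.
Qed.

Lemma int_norm_lt1 (R : archiRealFieldType) (a : R) :
  a \is a Num.int -> `|a| < 1 -> a = 0.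
Proof.
move=> /intrP[z ->]; rewrite -intr_norm -[1]/(1%:~R) ltr_int => z1.
by rewrite (_ : z = 0) //; lia.
Qed.

(** The values at [e] and [e / 2] differ by a nonzero amount below 1, so they cannot both be
    integers. In the coset lemma this keeps the remainder of a rounding strictly positive. *)
Lemma small_non_integer (R : archiRealFieldType) (t z e0 : R) :
  z != 0 -> 0 < e0 -> exists2 e, 0 < e <= e0 & t + e * z \isn't a Num.int.
Proof.
move=> z0 e0_gt0; pose e := Num.min e0 (`|z|^-1 / 2).
have e_gt0 : 0 < e by rewrite lt_min e0_gt0 divr_gt0 // invr_gt0 normr_gt0.
have ez : e * `|z| <= 2^-1.
  rewrite -ler_pdivlMr ?normr_gt0 // [leRHS]mulrC /e.
  by rewrite ge_min lexx orbT.
have [ei|] := boolP (t + e * z \is a Num.int); last first.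
  by exists e => //; rewrite e_gt0 ge_min lexx.
exists (e / 2).
  rewrite divr_gt0 //=; apply: le_trans (_ : e <= _); last by rewrite ge_min lexx.
  by rewrite ler_pdivrMr // ler_peMr ?ler1n // ltW.
apply/negP => e2i; have := rpredB ei e2i.
have -> : t + e * z - (t + e / 2 * z) = e * z / 2 by field.
move=> /int_norm_lt1 => /(_ _)/wrap[].
  by rewrite !normrM (gtr0_norm e_gt0) [`|2^-1|]ger0_norm ?invr_ge0 //; lra.
move=> /eqP; rewrite mulf_eq0 mulf_eq0 invr_eq0 (negbTE z0) gt_eqF //=.
by rewrite pnatr_eq0.
Qed.

(** The direction [e] decreases only weights that are positive, so finitely many strict inequalities
    bound the step. The 1 added to the norm of [e i] avoids a division by zero. *)
Lemma perturb (R : realFieldType) (I : finType) (a e : I -> R) :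
  (forall i, 0 <= a i) -> (forall i, e i < 0 -> 0 < a i) ->
  exists2 d, 0 < d & forall c, 0 <= c <= d ->
    forall i, 0 <= a i + c * e i /\ (0 < a i -> 0 < a i + c * e i).
Proof.
move=> a_ge0 ea.
have [i|d d_gt0 hd] := @pos_lower_bound R I
    (fun i => if 0 < a i then a i / (1 + `|e i|) / 2 else 1).
  case: ifP => // ai; rewrite !divr_gt0 // ltr_pwDl //.
exists d => // c /andP[c_ge0 cd] i; have := hd i.
have N1 : 0 < 1 + `|e i| by rewrite ltr_pwDl.
case: ifPn => [ai|ai].
  move=> di; suff h : 0 < a i + c * e i by split=> //; exact: ltW.
  have ci : c <= a i / (1 + `|e i|) / 2 by exact: le_trans di.
  have : c * (1 + `|e i|) <= a i / 2.
    by rewrite -ler_pdivlMr // mulrAC.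
  have : - (c * `|e i|) <= c * e i.
    by rewrite -mulrN ler_wpM2l // lerNl -normrN ler_norm.
  by nra.
move=> _; split=> //.
have -> : a i = 0 by apply/eqP; rewrite eq_le a_ge0 leNgt ai.
rewrite add0r mulr_ge0 // leNgt; apply: contra ai; exact: ea.
Qed.

(* The coset w + ZX meets the relative interior of the Minkowski sum of the
   polytopes conv {x i | col j i}, j in S.  Starting from the single colour j0
   the colours are added one at a time; [t] records the coordinates of the
   error along the edges of the colours that are still missing. *)
Lemma coset_meets_interior (R : realType) (n : nat) (I J : finType)
    (x : I -> 'rV[R]_n) (col : J -> pred I) (b b' : J -> I) (S : {set J})
    (j0 : J) (w : 'rV[R]_n) :
  let z j := x (b' j) - x (b j) in
  j0 \in S ->
  (forall j, j \in S -> col j (b j)) ->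
  (forall j, j \in S -> j != j0 -> col j (b' j)) ->
  (forall j i, j \in S -> col j i ->
     (x i - x (b j) <= rowspan [in S :\ j0] z)%MS) ->
  (forall U : {set J}, j0 \in U -> U \proper S -> exists j i,
     [/\ j \in U, col j i & ~~ (x i - x (b j) <= rowspan [in U :\ j0] z)%MS]) ->
  (w <= rowspan [in S :\ j0] z)%MS ->
  exists (a : I -> R) (c : I -> int),
  [/\ forall i, 0 <= a i,
      forall i, a i != 0 -> exists2 j, j \in S & col j i,
      \sum_i a i = #|S|%:R,
      \sum_i a i *: x i = w + \sum_i (c i)%:~R *: x i
    & forall u, (forall i, 0 <= pairing u (x i)) ->
        pairing u (\sum_i a i *: x i) = 0 ->
        forall j i, j \in S -> col j i -> pairing u (x i) = 0].
Proof.
move=> z j0S colb colb' zspan grow wz.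
(* Positivity at both ends of each chosen edge makes the final point interior, and at every stage it
   leaves room to move backwards along these edges. The colour [j0] has no edge, only the end
   [b j0]. *)
pose inv (U : {set J}) (a : I -> R) (c : I -> int) (t : J -> R) :=
  [/\ forall i, 0 <= a i,
      forall i, a i != 0 -> exists2 j, j \in U & col j i,
      forall j, j \in U -> 0 < a (b j) /\ (j != j0 -> 0 < a (b' j)),
      \sum_i a i = #|U|%:R
    & \sum_i a i *: x i =
      w + \sum_i (c i)%:~R *: x i + \sum_(j in S :\: U) t j *: z j].
have step k : (k < #|S|)%N ->
    exists (U : {set J}) a c t, [/\ U \subset S, j0 \in U, #|U| = k.+1 & inv U a c t].
  elim: k => [|k IH] kS.
    have /rowspanP[t wE] := wz.
    exists [set j0], (fun i => (i == b j0)%:R), (fun i => (i == b j0)%:Z),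
      (fun j => - t j).
    split; rewrite ?finset.sub1set ?cards1 ?inE //; split.
    - by move=> i; rewrite ler0n.
    - move=> i; case: (eqVneq i (b j0)) => [->|]; last by rewrite eqxx.
      by exists j0; rewrite ?inE // colb.
    - by move=> j; rewrite inE => /eqP ->; rewrite !eqxx ltr01.
    - by rewrite (bigD1 (b j0)) //= eqxx big1 ?addr0 ?cards1 // => i /negbTE ->.
    - have -> : \sum_i ((i == b j0)%:Z)%:~R *: x i = x (b j0).
        by under eq_bigr do rewrite -pmulrn; exact: sum_deltaZ.
      rewrite wE; under [X in _ + _ + X]eq_bigr do rewrite scaleNr.
      by rewrite sumrN addrAC subrr add0r.
  have [U [a [c [t [US j0U cU [a_ge0 aU apos suma sumax]]]]]] := IH (ltnW kS).
  have U_proper : U \proper S by rewrite properEcard US cU.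
  have [j [i0 [jU ji0 nspan]]] := grow U j0U U_proper.
  have jS := fintype.subsetP US _ jU.
  have /rowspanP[q qE] := zspan j i0 jS ji0.
  have splitS (f : J -> 'rV[R]_n) : \sum_(l in S :\ j0) f l =
      \sum_(l in U :\ j0) f l + \sum_(l in S :\: U) f l.
    rewrite (bigID [in U]) /=; congr (_ + _); apply: eq_bigl => l; rewrite !inE.
      by case: (boolP (l \in U)) => [/(fintype.subsetP US) ->|]; rewrite ?andbT ?andbF.
    by case: (eqVneq l j0) => [->|]; rewrite ?j0U //= ?andbT andbC.
  have [s sSU qs] : exists2 s, s \in S :\: U & q s != 0.
    apply: contrapT => no; move/negP: nspan; apply.
    apply/rowspanP; exists q; rewrite qE splitS [X in _ + X]big1 ?addr0 // => l lSU.
    have [->|ql] := eqVneq (q l) 0; first by rewrite scale0r.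
    by case: no; exists l.
  have [sS sU] : s \in S /\ s \notin U by move: sSU; rewrite inE => /andP[].
  (* Move from [b j] to [i0] and undo, along the edges of [U], the part of this move that they span.
     What remains is a combination of the missing edges with nonzero coefficient [q s]. Only ends of
     chosen edges can lose weight. *)
  pose e i : R := (i == i0)%:R - (i == b j)%:R -
    \sum_(l in U :\ j0) q l * ((i == b' l)%:R - (i == b l)%:R).
  have sume (V : lmodType R) (f : I -> V) : \sum_i e i *: f i = f i0 - f (b j) -
      \sum_(l in U :\ j0) q l *: (f (b' l) - f (b l)).
    under eq_bigr do rewrite !scalerBl scaler_suml.
    rewrite !sumrB !sum_deltaZ exchange_big /=; congr (_ - _).
    apply: eq_bigr => l _; under eq_bigr do rewrite -scalerA.
    rewrite -scaler_sumr; under eq_bigr do rewrite scalerBl.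
    by rewrite sumrB !sum_deltaZ.
  have e_neg i : e i < 0 -> 0 < a i.
    move=> ei; rewrite lt_neqAle eq_sym a_ge0 andbT; apply: contraL ei => /eqP ai.
    have nb l : l \in U -> (i == b l) = false.
      by move=> /apos[bl _]; apply/eqP => ib; rewrite -ib ai ltxx in bl.
    have nb' l : l \in U :\ j0 -> (i == b' l) = false.
      rewrite !inE => /andP[l0 /apos[_ /(_ l0)bl]].
      by apply/eqP => ib; rewrite -ib ai ltxx in bl.
    rewrite -leNgt /e nb // big1 ?subr0 ?ler0n // => l lU.
    by rewrite nb' // nb ?subrr ?mulr0 //; move: lU; rewrite inE => /andP[].
  have [d d_gt0 hd] := perturb a_ge0 e_neg.
  (* The step makes the error [th] along [z s] non-integral. The new colour [s] enters with weight
     [1 - r] at [b s] and [r] at [b' s], which raises the error to its ceiling [m]; the integral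
     part moves into [c']. Since [r] is strictly between 0 and 1, both ends get positive weight. *)
  have [p /andP[p_gt0 pd] pN] := small_non_integer (t s) qs d_gt0.
  have {hd} hp := hd p; rewrite (ltW p_gt0) pd in hp; have {}hp := hp isT.
  pose th := t s + p * q s; pose m := Num.ceil th; pose r := m%:~R - th.
  have r_gt0 : 0 < r.
    rewrite subr_gt0 lt_neqAle ceil_ge andbT.
    by apply: contraNneq pN => thE; rewrite -/th thE; exact: intr_int.
  have r_lt1 : 0 < 1 - r.
    by have := ceilB1_lt th; rewrite /r -/m intrD; lra.
  pose a' i := a i + p * e i + (1 - r) * (i == b s)%:R + r * (i == b' s)%:R.
  have aa' i : a i + p * e i <= a' i.
    by rewrite /a' -addrA ler_wpDr // addr_ge0 ?mulr_ge0 ?ler0n // ltW.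
  pose c' i := c i + (1 - m) * (i == b s)%:Z + m * (i == b' s)%:Z.
  exists (s |: U), a', c', (fun l => t l + p * q l).
  split.
  - by rewrite finset.subUset finset.sub1set sS.
  - by rewrite inE j0U orbT.
  - by rewrite cardsU1 sU cU.
  have s0 : s != j0 by apply: contraNneq sU => ->.
  have suma' (V : lmodType R) (f : I -> V) : \sum_i a' i *: f i =
      \sum_i a i *: f i + p *: (\sum_i e i *: f i) + (1 - r) *: f (b s) + r *: f (b' s).
    under eq_bigr do rewrite !scalerDl -!scalerA.
    by rewrite !big_split /= -!scaler_sumr !sum_deltaZ.
  split.
  - by move=> i; apply: le_trans (aa' i); exact: (hp i).1.
  - move=> i; have [bsi _|/negbTE ibs] := eqVneq i (b s).
      by exists s; rewrite ?inE ?eqxx // bsi colb.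
    have [bsi _|/negbTE ib's] := eqVneq i (b' s).
      by exists s; rewrite ?inE ?eqxx // bsi colb'.
    rewrite /a' ibs ib's !mulr0 !addr0 => ai.
    suff [l lU li] : exists2 l, l \in U & col l i by exists l; rewrite // inE lU orbT.
    have [ai0|/aU//] := eqVneq (a i) 0.
    move: ai; rewrite ai0 add0r mulf_eq0 negb_or => /andP[_ ei].
    have [i0i|/negbTE ii0] := eqVneq i i0; first by exists j; rewrite // i0i.
    apply: contrapT => no; case/eqP: ei.
    have nb l : l \in U -> (i == b l) = false.
      move=> lU; apply/eqP => ibl; apply: no; exists l => //.
      by rewrite ibl colb // (fintype.subsetP US).
    rewrite /e ii0 nb // big1 ?subr0 // => l; rewrite !inE => /andP[l0 lU].
    rewrite nb // subr0 (_ : (i == _) = false) ?mulr0 //.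
    apply/eqP => ibl; apply: no; exists l => //.
    by rewrite ibl colb' // (fintype.subsetP US).
  - move=> l; rewrite !inE => /orP[/eqP ->|lU].
      split=> [|_].
        rewrite /a' eqxx mulr1.
        apply: (@lt_le_trans _ _ (1 - r)) => //; rewrite -[leLHS]add0r -addrA.
        apply: lerD; first exact: (hp _).1.
        by rewrite ler_wpDr // mulr_ge0 ?ler0n // ltW.
      rewrite /a' eqxx mulr1.
      apply: (@lt_le_trans _ _ r) => //; rewrite -[leLHS]add0r.
      apply: lerD => //; apply: addr_ge0; first exact: (hp _).1.
      by rewrite mulr_ge0 ?ler0n // ltW.
    have [bl b'l] := apos l lU.
    split; first by apply: lt_le_trans (aa' _); apply: (hp _).2.
    by move=> /b'l b'l0; apply: lt_le_trans (aa' _); apply: (hp _).2.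
  - have E0 : \sum_i e i *: (1 : R^o) = 0.
      rewrite (sume R^o (fun=> 1)) subrr big1 ?subr0 // => l _.
      by rewrite ?subrr scaler0.
    have := suma' R^o (fun=> 1); rewrite E0 scaler0 addr0.
    under eq_bigr do rewrite [_ *: _]mulr1.
    under [X in X + _ + _]eq_bigr do rewrite [_ *: _]mulr1.
    rewrite suma ![_ *: 1]mulr1 => ->.
    by rewrite cardsU1 sU natrD [RHS]addrC -addrA subrK.
  - rewrite suma' sume sumax.
    have -> : \sum_i (c' i)%:~R *: x i =
        \sum_i (c i)%:~R *: x i + (1 - m)%:~R *: x (b s) + m%:~R *: x (b' s).
      under eq_bigr do rewrite /c' !intrD !intrM -!pmulrn !scalerDl -!scalerA.
      by rewrite !big_split /= -!scaler_sumr !sum_deltaZ.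
    have -> : x i0 - x (b j) - \sum_(l in U :\ j0) q l *: (x (b' l) - x (b l)) =
        \sum_(l in S :\: U) q l *: z l.
      by rewrite qE splitS addrAC subrr add0r.
    have -> : \sum_(l in S :\: (s |: U)) (t l + p * q l) *: z l =
        \sum_(l in S :\: U) (t l + p * q l) *: z l - th *: z s.
      rewrite [in RHS](bigD1 s) //= addrAC subrr add0r; apply: eq_bigl => l.
      by rewrite !inE negb_or -andbA andbC.
    have -> : \sum_(l in S :\: U) (t l + p * q l) *: z l =
        \sum_(l in S :\: U) t l *: z l + p *: \sum_(l in S :\: U) q l *: z l.
      under eq_bigr do rewrite scalerDl -scalerA.
      by rewrite big_split /= -scaler_sumr.
    move: (\sum_i _) (\sum_(l in _) _) (\sum_(l in _) _) => v1 v2 v3.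
    apply/rowP => k'; rewrite /r /z !mxE intrD intrN; ring.
have [U [a [c [t [US j0U cU [a_ge0 aU apos suma sumax]]]]]] : exists (U : {set J}) a c t,
    [/\ U \subset S, j0 \in U, #|U| = #|S| & inv U a c t].
  have S_gt0 : (0 < #|S|)%N by rewrite card_gt0; apply/set0Pn; exists j0.
  have := step #|S|.-1; rewrite prednK // leqnn; exact.
have UE : U = S by apply/eqP; rewrite eqEcard US cU leqnn.
rewrite UE in aU apos suma sumax.
exists a, c; split => //.
  by rewrite sumax finset.setDv big_set0 addr0.
(* A nonnegative [u] that vanishes at the point vanishes wherever [a] is positive, hence at all ends
   of edges; every vertex of a colour in [S] is one such end plus a combination of edges. *)
move=> u u0; rewrite pairing_sumZ => /psumr_eq0P su j i jS ji.
have ux k : 0 < a k -> pairing u (x k) = 0.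
  move=> ak; have := su (fun i _ => mulr_ge0 (a_ge0 i) (u0 i)) k isT.
  by move/eqP; rewrite mulf_eq0 gt_eqF //= => /eqP.
have /rowspanP[q qE] := zspan j i jS ji.
have -> : x i = x (b j) + \sum_(l in S :\ j0) q l *: z l by rewrite -qE addrC subrK.
rewrite pairingD pairing_sumZ ux ?(apos j jS).1 // add0r big1 // => l.
rewrite /= !inE => /andP[l0 lS]; rewrite pairingB !ux ?subrr ?mulr0 //.
  exact: (apos l lS).1.
exact: (apos l lS).2.
Qed.

(** * Splitting of Gorenstein cones *)

Lemma int_ge1 (R : archiRealFieldType) (a : R) :
  a \is a Num.int -> 0 < a -> 1 <= a.
Proof.
by move=> /intrP[z ->]; rewrite ltr0z -[1]/(1%:~R) ler_int; lia.
Qed.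

(** Subtracting a multiple of a linear relation among the terms in use, up to the smallest ratio
    [c j / a j], keeps the sum and kills a coefficient. Vectors are given by their values [f j i],
    the form in which functionals on a non-full-dimensional cone are compared. *)
Lemma caratheodory_cone (R : realFieldType) (I J : finType) (f : J -> I -> R)
    (t : I -> R) (c : J -> R) :
  (forall j, 0 <= c j) -> (forall i, \sum_j c j * f j i = t i) ->
  exists d : J -> R,
  [/\ forall j, 0 <= d j, forall i, \sum_j d j * f j i = t i
    & forall a : J -> R, (forall j, d j = 0 -> a j = 0) ->
        (forall i, \sum_j a j * f j i = 0) -> forall j, a j = 0].
Proof.
elim: {c}_.+1 {-2}c (ltnSn #|[set j | c j != 0]|) => // k IH c ck c_ge0 ct.
have [free|] := pselect (forall a : J -> R, (forall j, c j = 0 -> a j = 0) ->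
  (forall i, \sum_j a j * f j i = 0) -> forall j, a j = 0).
  by exists c.
move=> /existsNP[a /not_implyP[ac /not_implyP[a0 /existsNP[j0 aj0]]]].
wlog aj0_gt0 : a ac a0 aj0 / 0 < a j0 => [wlog_pos|].
  have [|aj0_le0] := ltP 0 (a j0); first exact: wlog_pos ac a0 aj0.
  apply: (wlog_pos (fun j => - a j)).
  - by move=> j /ac ->; rewrite oppr0.
  - by move=> i; under eq_bigr do rewrite mulNr; rewrite sumrN a0 oppr0.
  - by apply/eqP; rewrite oppr_eq0; apply/eqP.
  - by rewrite oppr_gt0 lt_neqAle aj0_le0 andbT; apply/eqP.
pose j1 := [arg min_(j < j0 | 0 < a j) (c j / a j)]%O.
have [aj1 minj1] : 0 < a j1 /\ forall j, 0 < a j -> c j1 / a j1 <= c j / a j.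
  by rewrite /j1; case: arg_minP => // j aj h; split.
pose q := c j1 / a j1.
have q_ge0 : 0 <= q by rewrite divr_ge0 // ltW.
apply: (IH (fun j => c j - q * a j)).
- rewrite -ltnS; apply: leq_trans ck; rewrite ltnS; apply: proper_card.
  apply/properP; split.
    apply/fintype.subsetP => j; rewrite !inE; apply: contraNneq => cj.
    by rewrite cj ac // mulr0 subr0.
  exists j1; rewrite !inE.
    by apply: contraTneq aj1 => /ac ->; rewrite ltxx.
  by rewrite negbK /q divfK ?subrr // gt_eqF.
- move=> j; rewrite subr_ge0; have [aj|aj] := ltP 0 (a j).
    by rewrite -ler_pdivlMr // minj1.
  by apply: le_trans (c_ge0 j); rewrite mulr_ge0_le0.
- move=> i; under eq_bigr do rewrite mulrBl -mulrA.
  by rewrite sumrB ct -mulr_sumr a0 mulr0 subr0.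
Qed.

Lemma pairing_rowspan (R : realType) (n : nat) (I : finType) (A : pred I)
    (x : I -> 'rV[R]_n) (u : 'cV[R]_n) (v : 'rV[R]_n) :
  (forall i, A i -> pairing u (x i) = 0) -> (v <= rowspan A x)%MS ->
  pairing u v = 0.
Proof.
move=> ux /rowspanP[c ->]; rewrite pairing_sumZ big1 // => i Ai.
by rewrite ux ?mulr0.
Qed.

Lemma row_sqr_eq0 (R : realType) (n : nat) (v : 'rV[R]_n) :
  pairing v^T v = 0 -> v = 0.
Proof.
rewrite /pairing mxE => /psumr_eq0P v0; apply/rowP => k; rewrite mxE.
have sq_ge0 l : true -> 0 <= v 0 l * v^T l 0 by rewrite mxE -expr2 sqr_ge0.
by have /eqP := v0 sq_ge0 k isT; rewrite mxE mulf_eq0 orbb => /eqP.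
Qed.

(** Each functional nonnegative on the cone is a combination of the [y j] on the span, so it kills
    [v]. Any functional becomes nonnegative after adding a large multiple of [h]; applied to the
    transpose of [v], this gives [v = 0]. *)
Lemma facets_separate (R : realType) (n : nat) (I J : finType)
    (x : I -> 'rV[R]_n) (y : J -> 'cV[R]_n) (h : 'cV[R]_n) (v : 'rV[R]_n) :
  (forall i, pairing h (x i) = 1) ->
  (forall u, (forall i, 0 <= pairing u (x i)) ->
     exists c : J -> R, (forall j, 0 <= c j) /\
       forall i, pairing u (x i) = \sum_j c j * pairing (y j) (x i)) ->
  (v <= rowspan predT x)%MS -> (forall j, pairing (y j) v = 0) -> v = 0.
Proof.
move=> hx cone vE yv; apply: row_sqr_eq0.
have pos u : (forall i, 0 <= pairing u (x i)) -> pairing u v = 0.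
  move=> /cone[c [_ cE]].
  rewrite -[u](subrK (\sum_j c j *: y j)) pairingDl pairing_sumZl.
  rewrite (pairing_rowspan _ vE) => [|i _].
    by rewrite add0r big1 // => j _; rewrite yv mulr0.
  by rewrite pairingBl pairing_sumZl cE subrr.
have hv : pairing h v = 0 by apply: pos => i; rewrite hx.
pose C := \sum_i `|pairing v^T (x i)|.
have : pairing (v^T + C *: h) v = 0.
  apply: pos => i; rewrite pairingDl pairingZl hx mulr1 -lerBlDl sub0r.
  apply: le_trans (ler_norm _) _; rewrite normrN /C (bigD1 i) //= lerDl.
  exact: sumr_ge0.
by rewrite pairingDl pairingZl hv mulr0 addr0.
Qed.

(** Subtracting a small multiple of the sum of all [y j] from [h] leaves it nonnegative. Expanding
    the difference and adding this multiple back makes every coefficient positive. *)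
Lemma positive_facet_combination (R : realType) (n : nat) (I J : finType)
    (x : I -> 'rV[R]_n) (y : J -> 'cV[R]_n) (h : 'cV[R]_n) :
  (forall i j, 0 <= pairing (y j) (x i)) ->
  (forall i, pairing h (x i) = 1) ->
  (forall u, (forall i, 0 <= pairing u (x i)) ->
     exists c : J -> R, (forall j, 0 <= c j) /\
       forall i, pairing u (x i) = \sum_j c j * pairing (y j) (x i)) ->
  exists be : J -> R, (forall j, 0 < be j) /\
    forall i, \sum_j be j * pairing (y j) (x i) = 1.
Proof.
move=> y_ge0 hx cone.
pose Y i := \sum_j pairing (y j) (x i).
have Y1 i : 0 < 1 + Y i by rewrite ltr_pwDl // sumr_ge0.
have [i|e e_gt0 eY] := @pos_lower_bound R I (fun i => (1 + Y i)^-1).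
  by rewrite invr_gt0.
have [i|c [c_ge0 cE]] := cone (h - \sum_j e *: y j).
  rewrite pairingBl pairing_sumZl hx -mulr_sumr -/(Y i) subr_ge0.
  have := eY i; rewrite -[_^-1]div1r ler_pdivlMr //; nra.
exists (fun j => c j + e); split=> [j|i]; first by rewrite ltr_wpDl.
under eq_bigr do rewrite mulrDl.
rewrite big_split /= -cE pairingBl pairing_sumZl hx.
by rewrite subrK.
Qed.

(** The colour [j0] is set apart because the differences of the colours in [S] span exactly |S| - 1
    dimensions: one edge [z j] for each other colour is a basis. The last clause records that no
    smaller set of colours containing [j0] is spanned by its own edges. *)
Lemma exists_minimal_colours (R : realType) (n r D : nat) (I J : finType)
    (x : I -> 'rV[R]_n) (y : J -> 'cV[R]_n) (h : 'cV[R]_n) (al : I -> R) :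
  (forall i j, pairing (y j) (x i) \is a Num.int) ->
  (forall i j, 0 <= pairing (y j) (x i)) ->
  (forall i, pairing h (x i) = 1) ->
  (forall u, (forall i, 0 <= pairing u (x i)) ->
     exists c : J -> R, (forall j, 0 <= c j) /\
       forall i, pairing u (x i) = \sum_j c j * pairing (y j) (x i)) ->
  (forall i, 0 < al i) -> \sum_i al i = r%:R ->
  (forall j, \sum_i al i * pairing (y j) (x i) = 1) ->
  \rank (rowspan predT x) = D -> (D + 2 <= 2 * r)%N ->
  exists (S : {set J}) (b b' : J -> I) (j0 : J),
    let col j i := pairing (y j) (x i) == 1 in
    let z j := x (b' j) - x (b j) in
  [/\ j0 \in S,
      forall i j, j \in S -> pairing (y j) (x i) = (col j i)%:R,
      forall i j j', j \in S -> j' \in S -> col j i -> col j' i -> j = j',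
      exists i, forall j, j \in S -> ~~ col j i
    & [/\ forall j, j \in S -> col j (b j),
      forall j, j \in S -> j != j0 -> col j (b' j),
      forall j i, j \in S -> col j i ->
        (x i - x (b j) <= rowspan [in S :\ j0] z)%MS
    & forall U : {set J}, j0 \in U -> U \proper S -> exists j i,
      [/\ j \in U, col j i & ~~ (x i - x (b j) <= rowspan [in U :\ j0] z)%MS]]].
Proof.
move=> yI y_ge0 hx cone al_gt0 suml suml1 rE rD.
pose N i j := pairing (y j) (x i).
have N_ge0 i j : 0 <= N i j by exact: y_ge0.
have NI i j : N i j \is a Num.int by exact: yI.
have [c0 [c0_ge0 c0E]] : exists c : J -> R, (forall j, 0 <= c j) /\
    forall i, pairing h (x i) = \sum_j c j * N i j by apply: cone => i; rewrite hx.
have [|c [c_ge0 cE free]] :=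
  @caratheodory_cone R I J (fun j i => N i j) (fun=> 1) c0 c0_ge0.
  by move=> i; rewrite -c0E hx.
have {}cE i : \sum_j c j * N i j = 1 := cE i.
have pos (d : J -> R) : (forall j, 0 <= d j) -> (forall j, 0 < c j -> 0 < d j) ->
    forall i, 0 < \sum_j d j * N i j.
  move=> d_ge0 cd i; rewrite lt_neqAle eq_sym sumr_ge0 ?andbT; last first.
    by move=> j _; rewrite mulr_ge0.
  apply: contra_neq (oner_neq0 R) => /psumr_eq0P d0.
  rewrite -(cE i) big1 // => j _; have /eqP : d j * N i j = 0.
    by apply: d0 => // k _; rewrite mulr_ge0.
  rewrite mulf_eq0 => /orP[/eqP dj|/eqP ->]; last by rewrite mulr0.
  have [->|cj] := eqVneq (c j) 0; first by rewrite mul0r.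
  by have := cd j; rewrite dj ltxx lt_neqAle eq_sym cj c_ge0 => /(_ isT).
have sumNI (P : pred J) i : \sum_(j | P j) N i j \is a Num.int by rewrite rpred_sum.
have N_neq0 j : exists i, N i j != 0.
  apply: contrapT => no; suff /eqP : 1 = 0 :> R by rewrite oner_eq0.
  rewrite -(suml1 j); apply: big1 => i _; rewrite -/(N i j).
  have [->|Nij] := eqVneq (N i j) 0; first by rewrite mulr0.
  by case: no; exists i.
(* If [c j0 > 1], then [1 - N i j0] is a positive integer for every [i], so [y j0] would vanish on
   all vertices. *)
have c_le1 j0 : c j0 <= 1.
  rewrite leNgt; apply/negP => cj0.
  have [i /negP] := N_neq0 j0; apply; rewrite eq_le N_ge0 andbT.
  have : 0 < \sum_j (c j - (j == j0)%:R) * N i j.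
    have d_gt0 j : 0 < c j -> 0 < c j - (j == j0)%:R.
      by have [->|] := eqVneq j j0; rewrite ?subr0 // subr_gt0.
    apply: pos => // j; have [->|] := eqVneq j j0; rewrite ?subr0 // subr_ge0.
    exact: ltW.
  have -> : \sum_j (c j - (j == j0)%:R) * N i j = 1 - N i j0.
    under eq_bigr do rewrite mulrBl.
    rewrite sumrB cE; congr (_ - _); rewrite (bigD1 j0) //= eqxx mul1r big1 ?addr0 //.
    by move=> j /negbTE ->; rewrite mul0r.
  by move=> /int_ge1; rewrite rpredB ?rpred1 //; move=> /(_ isT); lra.
pose J0 := [set j | c j != 0]; pose J1 := [set j | c j == 1].
have J10 : J1 \subset J0.
  by apply/fintype.subsetP => j; rewrite !inE => /eqP ->; exact: oner_neq0.
have cardJ : (2 * r <= #|J0| + #|J1|)%N.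
  (* These are the coefficients of the sum over [J0] plus the sum over [J1] minus the height. They
     are positive on the support of [c]: coefficients below 1 leave a remainder, and those equal to
     1 are counted twice. Weighting by [al] turns the pointwise bound 1 into r <= |J0| + |J1| -
     r. *)
  pose d j : R := (j \in J0)%:R + (j \in J1)%:R - c j.
  have d_ge1 i : 1 <= \sum_j d j * N i j.
    apply: int_ge1.
      have -> : \sum_j d j * N i j = \sum_(j in J0) N i j + \sum_(j in J1) N i j - 1.
        under eq_bigr do rewrite mulrBl mulrDl; rewrite sumrB big_split /= cE.
        by congr (_ + _ - _); rewrite [RHS]big_mkcond; apply: eq_bigr => j _;
          case: ifP => _; rewrite ?mul1r ?mul0r.
      by rewrite rpredB ?rpredD ?rpred1.
    have dP j : [/\ c j = 0 & d j = 0] \/ 0 < d j.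
      rewrite /d !inE; have [cj|cj] := eqVneq (c j) 0.
        by left; rewrite cj eq_sym oner_eq0 /= addr0 subr0.
      right; have [->|cj1] := eqVneq (c j) 1; first by rewrite addrK.
      by rewrite /= addr0 subr_gt0 lt_neqAle cj1 c_le1.
    by apply: pos => j; have [[cj dj]|dj] := dP j; rewrite ?cj ?dj ?ltxx // ltW.
  have : r%:R <= \sum_i al i * \sum_j d j * N i j.
    by rewrite -suml; apply: ler_sum => i _; rewrite ler_peMr // ltW.
  have -> : \sum_i al i * \sum_j d j * N i j = \sum_j d j.
    under eq_bigr do rewrite mulr_sumr; rewrite exchange_big /=.
    apply: eq_bigr => j _; under eq_bigr do rewrite mulrCA.
    by rewrite -mulr_sumr suml1 mulr1.
  have sumc : \sum_j c j = r%:R.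
    rewrite -suml; have <- : \sum_i al i * \sum_j c j * N i j = \sum_i al i.
      by apply: eq_bigr => i _; rewrite cE mulr1.
    apply: esym; under eq_bigr do rewrite mulr_sumr; rewrite exchange_big /=.
    apply: eq_bigr => j _; under eq_bigr do rewrite mulrCA.
    by rewrite -mulr_sumr suml1 mulr1.
  have sumJ (U : {set J}) : \sum_j (j \in U)%:R = #|U|%:R :> R.
    by rewrite -natr_sum; congr _%:R; rewrite -sum1_card [RHS]big_mkcond;
      apply: eq_bigr => j _; case: (j \in U).
  rewrite sumrB big_split /= !sumJ sumc -lerBDr opprK -!natrD ler_nat.
  by rewrite mul2n addnn.
have N_ge1 i j : N i j != 0 -> 1 <= N i j.
  by move=> Nij; apply: int_ge1 => //; rewrite lt_neqAle eq_sym Nij y_ge0.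
(* In the identity that the terms [c k * N i k] sum to 1, a term with coefficient 1 and a positive
   integral value already exhausts the total. *)
have excl i j : j \in J1 -> N i j != 0 ->
    N i j = 1 /\ forall j', j' \in J0 -> j' != j -> N i j' = 0.
  rewrite inE => /eqP cj /N_ge1 N1; have := cE i.
  rewrite (bigD1 j) //= cj mul1r => sumN.
  have rest_ge0 : forall k, k != j -> 0 <= c k * N i k by move=> k _; rewrite mulr_ge0.
  have rest := sumr_ge0 (index_enum J) rest_ge0.
  have Nij : N i j = 1 by apply/eqP; rewrite eq_le N1 andbT; lra.
  split=> // j'; rewrite inE => cj' jj'.
  have : \sum_(k | k != j) c k * N i k = 0 by lra.
  move=> /(psumr_eq0P rest_ge0) /(_ j' jj') /eqP.
  by rewrite mulf_eq0 (negbTE cj') => /eqP.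
pose col j i := N i j == 1.
have Ncol i j : j \in J1 -> N i j = (col j i)%:R.
  move=> jJ1; rewrite /col; have [->|N0] := eqVneq (N i j) 0.
    by rewrite eq_sym oner_eq0.
  by have [-> _] := excl i j jJ1 N0; rewrite eqxx.
pose E := rowspan predT x.
pose B : 'M[R]_(n, #|J0|) := \matrix_(k, l) y (enum_val l) k 0.
have mulB (v : 'rV[R]_n) l : (v *m B) 0 l = pairing (y (enum_val l)) v.
  by rewrite /pairing !mxE; apply: eq_bigr => k _; rewrite mxE.
(* The functionals indexed by [J0] are independent on the span of the vertices, so their common
   kernel there has dimension at most D - |J0|. *)
have rankEB : (#|J0| <= \rank (E *m B))%N.
  rewrite -mxrank_tr; suff /eqP -> : row_free (E *m B)^T by [].
  apply: inj_row_free => v v0; apply/rowP => l; rewrite mxE.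
  pose a j := \sum_k v 0 k * (j == enum_val k)%:R.
  have -> : v 0 l = a (enum_val l).
    rewrite /a (bigD1 l) //= eqxx mulr1 big1 ?addr0 // => k kl.
    by rewrite (inj_eq enum_val_inj) eq_sym (negbTE kl) mulr0.
  apply: free => [j cj|i].
    rewrite /a big1 // => k _; rewrite (_ : (_ == _) = false) ?mulr0 //.
    by apply/eqP => jk; have := enum_valP k; rewrite -jk inE cj eqxx.
  have xE : (x i <= E)%MS by apply: rowspan_sup.
  have /submxP[t tE] := xE.
  have : x i *m B *m v^T = 0.
    have EBv : E *m B *m v^T = 0 by rewrite -[E *m B]trmxK -trmx_mul v0 trmx0.
    by rewrite tE -[t *m E *m B]mulmxA -mulmxA EBv mulmx0.
  move=> /matrixP /(_ 0 0); rewrite !mxE => xBv.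
  rewrite /a; under eq_bigr do rewrite mulr_suml; rewrite exchange_big /= -[RHS]xBv.
  apply: eq_bigr => k _; rewrite mulB mxE (bigD1 (enum_val k)) //= eqxx mulr1 big1.
    by rewrite addr0 mulrC.
  by move=> j /negbTE ->; rewrite mulr0 mul0r.
have rankE : (\rank (E *m B) + \rank (E :&: kermx B) = D)%N.
  by rewrite mxrank_mul_ker.
have J1_ge2 : (2 <= #|J1|)%N by move: cardJ; lia.
have [j1 j1J1] : exists j, j \in J1 by apply/card_gt0P; lia.
have colne j : j \in J1 -> exists i, col j i.
  move=> jJ1; have [i] := N_neq0 j; rewrite Ncol // => Nij.
  by exists i; move: Nij; case: (col j i); rewrite ?eqxx.
have [i1 _] := colne j1 j1J1.
pose b j := odflt i1 [pick i | col j i].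
have colb j : j \in J1 -> col j (b j).
  move=> /colne[i ji]; rewrite /b; case: pickP => //= /(_ i); by rewrite ji.
pose Dif (U : {set J}) := (\sum_(j in U) rowspan (col j) (fun i => x i - x (b j)))%MS.
have rankJ1 : (\rank (Dif J1) + 2 <= #|J1|)%N.
  suff : (Dif J1 <= E :&: kermx B)%MS.
    by move=> /mxrankS; move: cardJ; lia.
  apply/sumsmx_subP => j jJ1; apply: rowspan_subP => i ji; rewrite sub_capmx.
  rewrite addmx_sub ?eqmx_opp ?rowspan_sup //=; apply/sub_kermxP.
  apply/rowP => l; rewrite mulB pairingB [RHS]mxE -!/(N _ _).
  (* Each functional in [J0] is constant on a colour of [J1], with value 1 for the functional of
     that colour and 0 for the others; so the differences lie in the common kernel. *)
  have Nj i' : col j i' -> N i' (enum_val l) = (enum_val l == j)%:R.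
    move=> /eqP ji'; have [->|lj] := eqVneq (enum_val l) j; first exact: ji'.
    have [|_ ->] // := excl i' j jJ1; first by rewrite ji' oner_neq0.
    exact: enum_valP.
  by rewrite !Nj ?subrr // colb.
have J1n0 : J1 != finset.set0 by apply/set0Pn; exists j1.
pose Q (U : {set J}) := [&& U != finset.set0, U \subset J1 & (\rank (Dif U) < #|U|)%N].
have [|S /minsetP[/and3P[S0 SJ1 rS] minS]] := @ex_minset _ Q.
  by exists J1; rewrite /Q J1n0 fintype.subxx /=; lia.
have rank_ge (U : {set J}) : U \proper S -> (#|U| <= \rank (Dif U))%N.
  move=> US; have [->|U0] := eqVneq U finset.set0; first by rewrite cards0.
  rewrite leqNgt; apply/negP => rU; have := US; rewrite (minS U) ?fintype.properxx //.
    by rewrite /Q U0 rU (fintype.subset_trans _ SJ1) // proper_sub.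
  exact: proper_sub.
have DifS (U V : {set J}) : U \subset V -> (Dif U <= Dif V)%MS.
  move=> UV; apply/sumsmx_subP => j jU.
  by apply: (sumsmx_sup j) => //; exact: (fintype.subsetP UV).
(* For [S = J1], dropping one colour would leave rank at least |J1| - 1, against at most |J1| - 2
   for all of [J1]. *)
have SnJ1 : S \proper J1.
  rewrite finset.properEneq SJ1 andbT; apply/eqP => SE.
  have cD1 : #|J1| = #|J1 :\ j1|.+1 by rewrite (cardsD1 j1) j1J1.
  have := rank_ge (J1 :\ j1); rewrite SE finset.properD1 // => /(_ isT).
  have := mxrankS (DifS _ _ (finset.subD1set J1 j1)).
  by move: rankJ1; rewrite cD1; lia.
have [j0 j0S] := set0Pn _ S0.
have cS : #|S| = #|S :\ j0|.+1 by rewrite (cardsD1 j0) j0S.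
have inJ1 := fintype.subsetP SJ1.
(* Rado's condition holds because every subset of [S :\ j0] is a proper subset of [S]. The |S| - 1
   independent edges then span [Dif S], whose rank is below |S|. *)
have [|b' [colb' rb']] := @independent_transversal R n I J col
    (fun j i => x i - x (b j)) b (S :\ j0) 0.
  move=> U US; rewrite mxrank0 addn0 -/(Dif U).
  apply: leq_trans (rank_ge U _) _; last by apply: mxrankS; exact: addsmxSr.
  by apply: sub_proper_trans US _; exact: finset.properD1.
pose z j := x (b' j) - x (b j).
have DifE : (Dif S <= rowspan [in S :\ j0] z)%MS.
  have zD : (rowspan [in S :\ j0] z <= Dif S)%MS.
    apply: rowspan_subP => j /= jS; apply: (sumsmx_sup j).
      by move: jS; rewrite inE => /andP[].
    by apply: (@rowspan_sup _ _ _ _ (fun i => x i - x (b j))); exact: colb'.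
  rewrite -(mxrank_leqif_sup zD) eqn_leq mxrankS //=.
  by move: rb'; rewrite adds0mx mxrank0 addn0 => ->; rewrite -ltnS -cS.
exists S, b, b', j0; split=> //.
- by move=> i j /inJ1; exact: Ncol.
- move=> i j j' jS j'S /eqP ji /eqP j'i; apply/eqP; apply: contraT => jj'.
  have Nij : N i j != 0 by rewrite [N _ _]ji oner_neq0.
  have [_ /(_ j')] := excl i j (inJ1 _ jS) Nij.
  rewrite eq_sym jj' (fintype.subsetP J10) ?inJ1 // => /(_ isT isT) /eqP.
  by rewrite [N _ _]j'i oner_eq0.
- have /properP[_ [j2 j2J1 j2S]] := SnJ1.
  exists (b j2) => j jS; apply/negP => /eqP ji.
  have jj2 : j2 != j by apply: contraNneq j2S => ->.
  have [] := excl (b j2) j (inJ1 _ jS); first by rewrite [N _ _]ji oner_neq0.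
  move=> _ /(_ j2); rewrite (fintype.subsetP J10) // => /(_ isT jj2) /eqP.
  by rewrite (eqP (colb j2 j2J1)) oner_eq0.
split.
- by move=> j /inJ1; exact: colb.
- by move=> j jS jj0; apply: colb'; rewrite !inE jj0.
- move=> j i jS ji; apply: submx_trans DifE; apply: (sumsmx_sup j) => //.
  by apply: (@rowspan_sup _ _ _ _ (fun i => x i - x (b j))).
(* Otherwise the |U| - 1 edges of [U :\ j0] would span [Dif U], whose rank is at least |U|. *)
move=> U j0U US; apply: contrapT => no.
have cU : #|U| = #|U :\ j0|.+1 by rewrite (cardsD1 j0) j0U.
have : (Dif U <= rowspan [in U :\ j0] z)%MS.
  apply/sumsmx_subP => j jU; apply: rowspan_subP => i ji.
  by apply: contrapT => /negP nsp; apply: no; exists j, i; split.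
move=> /mxrankS rU; have := rank_rowspan_le (U :\ j0) z.
by move=> /(leq_trans rU); rewrite leqNgt -cU rank_ge.
Qed.

(** The sum of [al i *: x i] over [A] is the component of the interior lattice point in one factor.
    Its height [s] and its integrality are what make this factor Gorenstein. The last clause splits
    all lattice points of the span, not only combinations of vertices. *)
Lemma gorenstein_cone_splits (R : realType) (n r D : nat) (I J : finType)
    (x : I -> 'rV[R]_n) (y : J -> 'cV[R]_n) (h : 'cV[R]_n) (al : I -> R) :
  (forall i, x i \is a mxOver Num.int) ->
  (forall j g, (g <= rowspan predT x)%MS -> g \is a mxOver Num.int ->
     pairing (y j) g \is a Num.int) ->
  (forall i j, 0 <= pairing (y j) (x i)) ->
  (forall i, pairing h (x i) = 1) ->
  (forall u, (forall i, 0 <= pairing u (x i)) ->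
     exists c : J -> R, (forall j, 0 <= c j) /\
       forall i, pairing u (x i) = \sum_j c j * pairing (y j) (x i)) ->
  (forall i, 0 < al i) -> \sum_i al i = r%:R ->
  (forall j, \sum_i al i * pairing (y j) (x i) = 1) ->
  \rank (rowspan predT x) = D -> (D + 2 <= 2 * r)%N ->
  exists (A : pred I) (B : pred J) (s : nat),
  [/\ (exists i, A i) /\ (exists i, ~~ A i),
      forall i j, B j != A i -> pairing (y j) (x i) = 0,
      \sum_(i | A i) al i = s%:R,
      \sum_(i | A i) al i *: x i \is a mxOver Num.int
    & forall g, (g <= rowspan predT x)%MS -> g \is a mxOver Num.int ->
      exists g1 g2 : 'rV[R]_n, [/\ g = g1 + g2, (g1 <= rowspan A x)%MS,
        (g2 <= rowspan (predC A) x)%MS, g1 \is a mxOver Num.int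
        & g2 \is a mxOver Num.int]].
Proof.
move=> xI yI y_ge0 hx cone al_gt0 suml suml1 rE rD.
have xE i : (x i <= rowspan predT x)%MS by apply: rowspan_sup.
pose N i j := pairing (y j) (x i).
have N_ge0 i j : 0 <= N i j by exact: y_ge0.
have NI i j : N i j \is a Num.int by exact: yI.
have [S [b [b' [j0 split_colours]]]] :=
  exists_minimal_colours NI y_ge0 hx cone al_gt0 suml suml1 rE rD.
pose col : J -> pred I := fun j i => N i j == 1.
have {split_colours} [j0S Ncol col_inj [i2 i2S] [colb colb' zspan grow]] :
  let z j := x (b' j) - x (b j) in
  [/\ j0 \in S,
      forall i j, j \in S -> N i j = (col j i)%:R,
      forall i j j', j \in S -> j' \in S -> col j i -> col j' i -> j = j',
      exists i, forall j, j \in S -> ~~ col j i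
    & [/\ forall j, j \in S -> col j (b j),
      forall j, j \in S -> j != j0 -> col j (b' j),
      forall j i, j \in S -> col j i ->
        (x i - x (b j) <= rowspan [in S :\ j0] z)%MS
    & forall U : {set J}, j0 \in U -> U \proper S -> exists j i,
      [/\ j \in U, col j i & ~~ (x i - x (b j) <= rowspan [in U :\ j0] z)%MS]]]
  := split_colours.
have coset w := @coset_meets_interior R n I J x col b b' S j0 w j0S colb colb' zspan grow.
have [be [be_gt0 beE]] := positive_facet_combination y_ge0 hx cone.
pose A : pred I := fun i => [exists j in S, col j i].
pose B : pred J := fun j => [exists i, A i && (N i j != 0)].
have AP i : reflect (exists2 j, j \in S & col j i) (A i) by exact: exists_inP.
have NB i j : A i -> ~~ B j -> N i j = 0.
  move=> Ai; rewrite negb_exists => /forallP /(_ i); rewrite Ai /= negbK.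
  by move/eqP.
have sumA (V : nmodType) (f : I -> V) :
    \sum_(i | A i) f i = \sum_(j in S) \sum_(i | col j i) f i.
  rewrite (exchange_big_dep A) /=; last by move=> j i jS ji; apply/AP; exists j.
  apply: eq_bigr => i /AP[j jS ji]; rewrite (big_pred1 j) // => j' /=.
  apply/idP/eqP => [/andP[j'S j'i]|->]; last by rewrite jS.
  exact: col_inj j'i ji.
have sumcol j (f : I -> R) : j \in S -> \sum_i f i * N i j = \sum_(i | col j i) f i.
  move=> jS; rewrite [RHS]big_mkcond; apply: eq_bigr => i _; rewrite [N _ _]Ncol //.
  by case: (col j i); rewrite ?mulr1 ?mulr0.
have alA : \sum_(i | A i) al i = #|S|%:R.
  rewrite sumA (eq_bigr (fun=> 1)) => [|j jS]; first by rewrite sumr_const.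
  by rewrite -sumcol //; exact: suml1.
have int_comb (c : I -> int) : \sum_i (c i)%:~R *: x i \is a mxOver Num.int.
  by apply: int_mx_sum => i _; rewrite int_mxZ ?intr_int.
have subA : (rowspan A x <= rowspan predT x)%MS by apply: rowspan_subP => i _.
have killA j v : ~~ B j -> (v <= rowspan A x)%MS -> pairing (y j) v = 0.
  by move=> Bj; apply: pairing_rowspan => i Ai; exact: NB.
(* The weights [be] express the height through all facets, so the last clause says that [u] has
   height |S|. *)
have interior w : (w <= rowspan [in S :\ j0] (fun j => x (b' j) - x (b j)))%MS ->
    exists (u : 'rV[R]_n) (c : I -> int),
    [/\ u = w + \sum_i (c i)%:~R *: x i, (u <= rowspan A x)%MS,
        forall j, B j -> 0 < pairing (y j) u
      & \sum_j be j * pairing (y j) u = #|S|%:R].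
  move=> /coset[a [c [a_ge0 aA suma sumax face]]].
  exists (\sum_i a i *: x i), c; split => //.
  - have {}aA i : ~~ A i -> a i = 0.
      by apply: contraNeq => /aA[j jS ji]; apply/AP; exists j.
    apply/rowspanP; exists a; rewrite [RHS]big_mkcond; apply: eq_bigr => i _.
    by case: ifPn => // /aA ->; rewrite scale0r.
  - move=> j /existsP[i /andP[/AP[k kS ki] Nij]]; rewrite lt_neqAle eq_sym.
    rewrite pairing_sumZ sumr_ge0 ?andbT; last by move=> l _; rewrite mulr_ge0.
    apply: contra Nij => /eqP ya; apply/eqP.
    by apply: (face (y j) _ _ k i) => //; rewrite pairing_sumZ.
  - under eq_bigr do rewrite pairing_sumZ mulr_sumr; rewrite exchange_big /= -suma.
    apply: eq_bigr => i _; under eq_bigr do rewrite mulrCA.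
    by rewrite -mulr_sumr beE mulr1.
have [v [c0 [vE vA v_gt0 vbe]]] := interior 0 (sub0mx _ _).
have vI : v \is a mxOver Num.int by rewrite vE add0r.
have v_ge1 j : B j -> 1 <= pairing (y j) v.
  by move=> Bj; apply: int_ge1; [apply: yI => //; exact: submx_trans subA|exact: v_gt0].
have sumB u : (u <= rowspan A x)%MS ->
    \sum_j be j * pairing (y j) u = \sum_(j | B j) be j * pairing (y j) u.
  move=> uA; rewrite [LHS](bigID B) /= [X in _ + X]big1 ?addr0 // => j Bj.
  by rewrite killA ?mulr0.
(* The facets in B have total weight exactly |S|: at most |S| because they are at
   least 1 at v, at least |S| because the other facets only meet vertices outside
   A.  Equality forces B to vanish outside A. *)
have be_le : \sum_(j | B j) be j <= #|S|%:R.
  rewrite -vbe sumB //; apply: ler_sum => j Bj; rewrite ler_peMr ?v_ge1 //.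
  exact: ltW.
have sumbe : \sum_j be j = r%:R.
  rewrite -suml; transitivity (\sum_j \sum_i be j * (al i * N i j)).
    by apply: eq_bigr => j _; rewrite -mulr_sumr suml1 mulr1.
  rewrite exchange_big; apply: eq_bigr => i _; under eq_bigr do rewrite mulrCA.
  by rewrite -mulr_sumr beE mulr1.
pose gap := \sum_(j | B j) \sum_(i | ~~ A i) be j * (al i * N i j).
have cross_ge0 j i : 0 <= be j * (al i * N i j).
  by rewrite mulr_ge0 ?mulr_ge0 // ltW.
have gapE : \sum_(i | ~~ A i) al i = \sum_(j | ~~ B j) be j + gap.
  transitivity (\sum_j \sum_(i | ~~ A i) be j * (al i * N i j)).
    rewrite exchange_big; apply: eq_bigr => i _; under eq_bigr do rewrite mulrCA.
    by rewrite -mulr_sumr beE mulr1.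
  rewrite (bigID B) /= addrC; congr (_ + _); apply: eq_bigr => j Bj.
  rewrite -mulr_sumr -[RHS]mulr1 -(suml1 j) [in RHS](bigID A) /=.
  by rewrite [X in _ = _ * (X + _)]big1 ?add0r // => i Ai; rewrite [pairing _ _]NB ?mulr0.
have gap_ge0 : 0 <= gap by apply: sumr_ge0 => j _; exact: sumr_ge0.
have [X0 beB] : gap = 0 /\ \sum_(j | B j) be j = #|S|%:R.
  move: sumbe suml; rewrite (bigID B) /= (bigID A) /= alA => h1 h2.
  by split; lra.
have NBA i j : B j -> ~~ A i -> N i j = 0.
  move=> Bj Ai; have X1 k : B k -> 0 <= \sum_(i | ~~ A i) be k * (al i * N i k).
    by move=> _; exact: sumr_ge0.
  have := psumr_eq0P X1 X0 Bj.
  move=> /(psumr_eq0P (fun i _ => cross_ge0 j i)) /(_ i Ai) /eqP.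
  by rewrite mulf_eq0 mulf_eq0 (gt_eqF (be_gt0 j)) (gt_eqF (al_gt0 i)) => /eqP.
(* The weights of [B] add up to |S|, so values at least 1 with weighted sum |S| must all equal 1. *)
have tight (u : 'rV[R]_n) : (u <= rowspan A x)%MS ->
    (forall j, B j -> 1 <= pairing (y j) u) ->
    \sum_j be j * pairing (y j) u = #|S|%:R -> forall j, B j -> pairing (y j) u = 1.
  move=> uA u_ge1; rewrite sumB // -beB => /eqP; rewrite -subr_eq0 -sumrB => /eqP.
  have ge0 j : B j -> 0 <= be j * pairing (y j) u - be j.
    by move=> Bj; rewrite subr_ge0 ler_peMr ?u_ge1 // ltW.
  move=> /(psumr_eq0P ge0) be0 j Bj; have /eqP := be0 j Bj.
  rewrite -[X in _ - X]mulr1 -mulrBr mulf_eq0 gt_eqF //= subr_eq0.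
  by move/eqP.
have v1 := tight v vA v_ge1 vbe.
have unique (u : 'rV[R]_n) : (u <= rowspan A x)%MS ->
    (forall j, B j -> pairing (y j) u = 1) -> u = v.
  move=> uA u1; apply/eqP; rewrite -subr_eq0; apply/eqP.
  have uvA : (u - v <= rowspan A x)%MS by rewrite addmx_sub ?eqmx_opp.
  apply: (facets_separate hx cone) => [|j].
    exact: submx_trans subA.
  by have [Bj|Bj] := boolP (B j); [rewrite pairingB u1 // v1 // subrr|exact: killA].
exists A, B, #|S|; split=> //.
- split; last by exists i2; apply/AP => -[j /i2S /negP].
  by exists (b j0); apply/AP; exists j0 => //; exact: colb.
- move=> i j; have [Ai|Ai] := boolP (A i); have [Bj|Bj] //= := boolP (B j).
    by move=> _; exact: NB.
  by move=> _; exact: NBA.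
- rewrite (_ : \sum_(i | A i) _ = v) //; apply: unique.
    by apply/rowspanP; exists al.
  move=> j Bj; rewrite pairing_sumZ -[RHS](suml1 j) [RHS](bigID A) /=.
  by rewrite [X in _ + X]big1 ?addr0 // => i Ai; rewrite [pairing _ _]NBA ?mulr0.
move=> g gE gI; have /rowspanP[d dE] := gE.
pose g1 := \sum_(i | A i) d i *: x i; pose g2 := \sum_(i | ~~ A i) d i *: x i.
have g12 : g = g1 + g2 by rewrite dE (bigID A).
have g1A : (g1 <= rowspan A x)%MS by apply/rowspanP; exists d.
have g2A : (g2 <= rowspan (predC A) x)%MS by apply/rowspanP; exists d.
have yg2 j : B j -> pairing (y j) g2 = 0.
  by move=> Bj; apply: pairing_rowspan g2A => i /= Ai; exact: NBA.
have yg1 j : B j -> pairing (y j) g1 \is a Num.int.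
  move=> Bj; have -> : pairing (y j) g1 = pairing (y j) g.
    by rewrite g12 pairingD yg2 // addr0.
  exact: yI.
have SB j : j \in S -> B j.
  move=> jS; apply/existsP; exists (b j); apply/andP; split.
    by apply/AP; exists j => //; exact: colb.
  by rewrite [N _ _]Ncol // colb // oner_neq0.
pose k j := Num.floor (pairing (y j) g1).
have kE j : j \in S -> (k j)%:~R = pairing (y j) g1.
  by move=> jS; apply: floorK; apply: yg1; exact: SB.
(* Within a colour [j] the coefficients [d i] add up to the integer [k j], the value of [y j] at
   [g1]. Removing that multiple of [x (b j)] leaves differences inside the colours, which the edges
   span. *)
pose w := g1 - \sum_(j in S) (k j)%:~R *: x (b j).
have [|u [c [uE uA u_gt0 ube]]] := interior w.
  have -> : w = \sum_(j in S) \sum_(i | col j i) d i *: (x i - x (b j)).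
    rewrite /w /g1 sumA -sumrB; apply: eq_bigr => j jS.
    under [RHS]eq_bigr do rewrite scalerBr.
    rewrite sumrB -scaler_suml kE //; congr (_ - _ *: _).
    rewrite pairing_sumZ -sumcol // big_mkcond; apply: eq_bigr => i _.
    case: ifPn => // Ai; rewrite (_ : N i j = 0) ?mulr0 // NBA //; exact: SB.
  apply: summx_sub => j jS; apply: summx_sub => i ji; apply: scalemx_sub.
  exact: zspan.
have wI : u - g1 \is a mxOver Num.int.
  rewrite uE /w addrAC [g1 - _]addrC addrK addrC int_mxB //.
  by apply: int_mx_sum => j _; rewrite int_mxZ ?intr_int.
(* Since [u - g1] is integral and [g1] has integral values on the facets in [B], so does [u];
   positivity and height |S| then identify it with [v]. *)
have uv : u = v.
  apply: unique => //; apply: tight => // j Bj; apply: int_ge1 (u_gt0 j Bj).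
  rewrite -[u](subrK g1) pairingD rpredD ?yg1 // yI //.
  by rewrite addmx_sub ?eqmx_opp //; exact: submx_trans subA.
have g1I : g1 \is a mxOver Num.int.
  by rewrite -[g1](subKr u) int_mxB // uv.
exists g1, g2; split=> //; rewrite -[g2](addKr g1) -g12 addrC int_mxB //.
Qed.

(** * Finitely generated cones *)

(** Induction on the number of generators. If the separator [u] for the others is negative on [a0],
    project along [a0] onto the kernel of [u]. A combination of the projections lifts, the signs of
    [u] making the coefficient of [a0] nonnegative; a separator of the projections pulls back to one
    that vanishes on [a0]. *)
Lemma farkas_ord (R : realType) (n k : nat) (a : 'I_k -> 'rV[R]_n)
    (v : 'rV[R]_n) :
  (exists c : 'I_k -> R, (forall i, 0 <= c i) /\ v = \sum_i c i *: a i) \/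
  (exists u : 'cV[R]_n, (forall i, 0 <= pairing u (a i)) /\ pairing u v < 0).
Proof.
elim: k a v => [|k IH] a v.
  have [->|v0] := eqVneq v 0.
    by left; exists (fun=> 0); split=> [[]//|]; rewrite big_ord0.
  right; exists (- v^T); split=> [[]//|].
  rewrite -scaleN1r pairingZl mulN1r oppr_lt0 lt_neqAle eq_sym.
  apply/andP; split; first by apply: contra v0 => /eqP /row_sqr_eq0 /eqP.
  by rewrite /pairing mxE sumr_ge0 // => i _; rewrite mxE -expr2 sqr_ge0.
pose a0 := a ord0; pose a1 i := a (lift ord0 i).
have ordP (P : 'I_k.+1 -> Prop) : P ord0 -> (forall i, P (lift ord0 i)) -> forall i, P i.
  by move=> P0 P1 i; have [j ->|->] := unliftP ord0 i.
have cons_cone c0 c : 0 <= c0 -> (forall i, 0 <= c i) ->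
    v = c0 *: a0 + \sum_i c i *: a1 i ->
    exists c : 'I_k.+1 -> R, (forall i, 0 <= c i) /\ v = \sum_i c i *: a i.
  move=> c0_ge0 c_ge0 ->; exists (fun i => oapp c c0 (unlift ord0 i)).
  split; first by apply: ordP => [|i]; rewrite ?unlift_none ?liftK /=.
  by rewrite big_ord_recl unlift_none; under [in RHS]eq_bigr do rewrite liftK.
have [[c [c_ge0 vE]]|[u [u_ge0 uv]]] := IH a1 v.
  by left; apply: (cons_cone 0 c) => //; rewrite scale0r add0r.
have [ua0|ua0] := leP 0 (pairing u a0); first by right; exists u; split=> //; exact: ordP.
pose pr w : 'rV[R]_n := w - (pairing u w / pairing u a0) *: a0.
have [[c [c_ge0 vE]]|[u' [u'_ge0 u'v]]] := IH (fun i => pr (a1 i)) (pr v).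
  left; apply: (cons_cone (pairing u v / pairing u a0 -
      \sum_i c i * (pairing u (a1 i) / pairing u a0)) c) => //.
    apply: addr_ge0.
      by apply: mulr_le0; rewrite ?invr_le0 ltW.
    rewrite -sumrN sumr_ge0 // => i _; rewrite -mulrN mulr_ge0 // -mulrN.
    by rewrite mulr_ge0 // -invrN invr_ge0 oppr_ge0 ltW.
  rewrite -[LHS](subrK ((pairing u v / pairing u a0) *: a0)) -/(pr v) vE.
  under eq_bigr do rewrite scalerBr scalerA.
  rewrite sumrB -scaler_suml scalerBl addrC addrA addrAC.
  by rewrite -addrA [- _ + _]addrC addrA.
right; pose q := pairing u' a0 / pairing u a0.
have prE w : pairing (u' - q *: u) w = pairing u' (pr w).
  by rewrite pairingBl pairingZl pairingB pairingZ /q; congr (_ - _); ring.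
exists (u' - q *: u); split; last by rewrite prE.
apply: ordP => [|i]; rewrite prE; last exact: u'_ge0.
by rewrite /pr divff ?lt_eqF // scale1r subrr pairing0.
Qed.

Lemma farkas (R : realType) (n : nat) (I : finType) (x : I -> 'rV[R]_n)
    (v : 'rV[R]_n) :
  (exists c : I -> R, (forall i, 0 <= c i) /\ v = \sum_i c i *: x i) \/
  (exists u : 'cV[R]_n, (forall i, 0 <= pairing u (x i)) /\ pairing u v < 0).
Proof.
have [[c [c_ge0 ->]]|[u [u_ge0 uv]]] := farkas_ord (x \o @enum_val I predT) v.
  left; exists (c \o enum_rank); split=> [i|]; first exact: c_ge0.
  rewrite [RHS](reindex (@enum_val I predT)) /=; last exact/onW_bij/enum_val_bij.
  by apply: eq_bigr => i _; rewrite enum_valK.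
right; exists u; split=> // i; have := u_ge0 (enum_rank i).
by rewrite /= enum_rankK.
Qed.

(** Farkas is applied to the lists of values on the [x i]. A separator of such lists is a list of
    coefficients, hence a point of the span of the [x i] that contradicts the hypothesis. *)
Lemma dual_farkas (R : realType) (n : nat) (I J : finType)
    (x : I -> 'rV[R]_n) (y : J -> 'cV[R]_n) (u : 'cV[R]_n) :
  (forall v, (v <= rowspan predT x)%MS -> (forall j, 0 <= pairing (y j) v) ->
     0 <= pairing u v) ->
  exists c : J -> R, (forall j, 0 <= c j) /\
    forall i, pairing u (x i) = \sum_j c j * pairing (y j) (x i).
Proof.
move=> hu; pose val (w : 'cV[R]_n) := \row_(k < #|I|) pairing w (x (enum_val k)).
have [[c [c_ge0 uE]]|[z [z_ge0 zu]]] := farkas (fun j => val (y j)) (val u).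
  exists c; split=> // i; have /rowP /(_ (enum_rank i)) := uE.
  rewrite mxE enum_rankK summxE => ->; apply: eq_bigr => j _.
  by rewrite !mxE enum_rankK.
pose v := \sum_k z k 0 *: x (enum_val k).
have valE w : pairing w v = pairing z (val w).
  rewrite pairing_sumZ [RHS]/pairing mxE; apply: eq_bigr => k _.
  by rewrite mxE mulrC.
have y_ge0 j : 0 <= pairing (y j) v by rewrite valE.
have vE : (v <= rowspan predT x)%MS.
  by apply: summx_sub => k _; apply: scalemx_sub; exact: rowspan_sup.
by have := hu v vE y_ge0; rewrite valE leNgt zu.
Qed.

(* Rotate a separating hyperplane about its contact set until it supports a
   facet of the cone. *)
Lemma facet_separation (R : realType) (n : nat) (I : finType)
    (x : I -> 'rV[R]_n) (v : 'rV[R]_n) :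
  (v <= rowspan predT x)%MS ->
  ~ (exists c : I -> R, (forall i, 0 <= c i) /\ v = \sum_i c i *: x i) ->
  exists u : 'cV[R]_n, [/\ forall i, 0 <= pairing u (x i), pairing u v < 0
    & \rank (rowspan predT x) =
      (\rank (rowspan (fun i => pairing u (x i) == 0) x)).+1].
Proof.
move=> vE ncone; have [//|[u [u_ge0 uv]]] := farkas x v.
set E := rowspan predT x in vE *.
pose Z (u : 'cV[R]_n) := rowspan (fun i => pairing u (x i) == 0) x.
have [k] := ubnP (\rank E - \rank (Z u)); elim: k u u_ge0 uv => // k IH u u_ge0 uv rk.
have ZE w : (Z w <= E)%MS by apply: rowspan_subP => i _; exact: rowspan_sup.
have Zkill w z : (z <= Z w)%MS -> pairing w z = 0.
  by apply: pairing_rowspan => i /eqP.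
have rZ : (\rank (Z u) < \rank E)%N.
  apply: rank_ltmx; rewrite ltmxE ZE; apply/negP => EZ.
  by have := uv; rewrite (Zkill u v) ?ltxx // (submx_trans vE).
have [rE|rE] := eqVneq (\rank E) (\rank (Z u)).+1; first by exists u; split.
(* The contact set and [v] together span too little, so some [f] vanishes on both without vanishing
   on the cone. Adding multiples of [f] to [u] keeps the value at [v] and the old contacts; the
   smallest ratio [rat] is where a new generator joins them. *)
pose W := (Z u + <<v>>)%MS.
have rW : (\rank W < \rank E)%N.
  have rW1 : (\rank W <= \rank (Z u) + \rank v)%N.
    by apply: leq_trans (leq_of_leqif (mxrank_adds_leqif _ _)) _; rewrite genmxE.
  by move: rZ rE rW1 (rank_leq_row v); lia.
have [i0 [f [fZ fv fi0]]] : exists i0 (f : 'cV[R]_n),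
    [/\ forall z, (z <= Z u)%MS -> pairing f z = 0, pairing f v = 0
      & pairing f (x i0) < 0].
  have [i0 i0W] : exists i0, ~~ (x i0 <= W)%MS.
    apply: contrapT => no; move: rW; rewrite ltnNge mxrankS //.
    apply: rowspan_subP => i _; apply: contrapT => /negP xi.
    by apply: no; exists i.
  have colM z l : pairing (col l (cokermx W)) z = (z *m cokermx W) 0 l.
    by rewrite /pairing !mxE; apply: eq_bigr => k' _; rewrite mxE.
  have [l wl] : exists l, pairing (col l (cokermx W)) (x i0) != 0.
    apply: contrapT => no; move: i0W; rewrite submxE => /eqP; apply.
    apply/rowP => l; rewrite [RHS]mxE; apply: contrapT => /eqP wl.
    by apply: no; exists l; rewrite colM.
  have killW z : (z <= W)%MS -> pairing (col l (cokermx W)) z = 0.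
    by rewrite submxE colM => /eqP ->; rewrite mxE.
  have ZW z : (z <= Z u)%MS -> (z <= W)%MS.
    by move=> zZ; apply: submx_trans (addsmxSl _ _).
  have vW : (v <= W)%MS by apply: submx_trans (addsmxSr _ _); rewrite genmxE.
  have [w0|w0] := ltP (pairing (col l (cokermx W)) (x i0)) 0.
    exists i0, (col l (cokermx W)); split=> //; last exact: killW.
    by move=> z /ZW; exact: killW.
  exists i0, (- 1 *: col l (cokermx W)); split.
  - by move=> z /ZW /killW w; rewrite pairingZl w mulr0.
  - by rewrite pairingZl killW ?mulr0.
  - by rewrite pairingZl mulN1r oppr_lt0 lt_neqAle eq_sym wl.
pose rat i := pairing u (x i) / - pairing f (x i).
pose i1 := [arg min_(i < i0 | pairing f (x i) < 0) rat i]%O.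
have [fi1 min1] : pairing f (x i1) < 0 /\
    forall i, pairing f (x i) < 0 -> rat i1 <= rat i.
  by rewrite /i1; case: arg_minP => // i fi hi; split.
have ui1 : pairing u (x i1) != 0.
  apply: contraTneq fi1 => ui1; rewrite fZ ?ltxx //.
  by apply: rowspan_sup; rewrite ui1.
have t_ge0 : 0 <= rat i1 by rewrite divr_ge0 // oppr_ge0 ltW.
pose u' := u + rat i1 *: f.
have u'E z : pairing u' z = pairing u z + rat i1 * pairing f z.
  by rewrite pairingDl pairingZl.
apply: (IH u').
- move=> i; rewrite u'E; have [fi|fi] := ltP (pairing f (x i)) 0; last first.
    by rewrite addr_ge0 // mulr_ge0.
  have := min1 i fi; rewrite {2}/rat ler_pdivlMr ?oppr_gt0 //; lra.
- by rewrite u'E fv mulr0 addr0.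
suff : (\rank (Z u) < \rank (Z u'))%N by move: rk (mxrankS (ZE u')); lia.
have u'Z z : (z <= Z u)%MS -> pairing u' z = 0.
  by move=> zZ; rewrite u'E fZ // mulr0 addr0; exact: Zkill.
have i1Z' : (x i1 <= Z u')%MS.
  apply: rowspan_sup; rewrite u'E /rat invrN mulrN mulNr divfK ?subrr //.
  by rewrite lt_eqF.
apply: rank_ltmx; rewrite ltmxE; apply/andP; split.
  apply: rowspan_subP => i /eqP ui; apply: rowspan_sup; rewrite u'Z //.
  by apply: rowspan_sup; rewrite ui.
by apply: contra ui1 => /(submx_trans i1Z') /Zkill ->.
Qed.

(** * Polytopes as sections of cones *)

(* Points of R^n at height t in the cone over R^n. *)
Definition hat (R : realType) (n : nat) (t : R) (p : 'rV[R]_n) : 'rV[R]_(n + 1) :=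
  row_mx p (const_mx t).

Definition height (R : realType) (n : nat) : 'cV[R]_(n + 1) :=
  col_mx 0 (const_mx 1).

Lemma hatD (R : realType) (n : nat) (s t : R) (p q : 'rV[R]_n) :
  hat s p + hat t q = hat (s + t) (p + q).
Proof. by rewrite /hat add_row_mx; congr row_mx; apply/rowP => i; rewrite !mxE. Qed.

Lemma hatZ (R : realType) (n : nat) (a t : R) (p : 'rV[R]_n) :
  a *: hat t p = hat (a * t) (a *: p).
Proof. by rewrite /hat scale_row_mx; congr row_mx; apply/rowP => i; rewrite !mxE. Qed.

Lemma hatB (R : realType) (n : nat) (s t : R) (p q : 'rV[R]_n) :
  hat s p - hat t q = hat (s - t) (p - q).
Proof. by rewrite -scaleN1r hatZ hatD mulN1r scaleN1r. Qed.

Lemma hat0 (R : realType) (n : nat) : hat 0 (0 : 'rV[R]_n) = 0.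
Proof. by rewrite /hat (_ : const_mx 0 = 0) ?row_mx0. Qed.

Lemma hat_sum (R : realType) (n : nat) (I : finType) (A : pred I) (c t : I -> R)
    (p : I -> 'rV[R]_n) :
  \sum_(i | A i) c i *: hat (t i) (p i) =
  hat (\sum_(i | A i) c i * t i) (\sum_(i | A i) c i *: p i).
Proof.
elim/big_rec3: _ => [|i y1 y2 y3 _ ->]; first by rewrite hat0.
by rewrite hatZ hatD.
Qed.

Lemma hat_inj (R : realType) (n : nat) (s t : R) (p q : 'rV[R]_n) :
  hat s p = hat t q -> s = t /\ p = q.
Proof.
by move=> /eq_row_mx[-> /rowP /(_ 0)]; rewrite !mxE.
Qed.

Lemma hatE (R : realType) (n : nat) (g : 'rV[R]_(n + 1)) :
  g = hat (rsubmx g 0 0) (lsubmx g).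
Proof.
rewrite -[LHS]hsubmxK /hat; congr row_mx; apply/rowP => i.
by rewrite !mxE !ord1.
Qed.

Lemma pairing_hat (R : realType) (n : nat) (u : 'cV[R]_n) (b t : R) (p : 'rV[R]_n) :
  pairing (col_mx u (const_mx b)) (hat t p) = pairing u p + t * b.
Proof.
by rewrite /pairing /hat mul_row_col mxE; congr (_ + _); rewrite mxE big_ord1 !mxE.
Qed.

Lemma pairing_height (R : realType) (n : nat) (t : R) (p : 'rV[R]_n) :
  pairing (height R n) (hat t p) = t.
Proof. by rewrite pairing_hat pairing0l add0r mulr1. Qed.

Lemma cV_hatE (R : realType) (n : nat) (u : 'cV[R]_(n + 1)) :
  u = col_mx (usubmx u) (const_mx (dsubmx u 0 0)).
Proof.
rewrite -[LHS]vsubmxK; congr col_mx; apply/colP => i.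
by rewrite !mxE !ord1.
Qed.

Lemma int_hat (R : realType) (n : nat) (t : R) (p : 'rV[R]_n) :
  (hat t p \is a mxOver Num.int) = (t \is a Num.int) && (p \is a mxOver Num.int).
Proof.
apply/idP/andP => [/mxOverP hI|[tI /mxOverP pI]]; last apply/mxOverP => i j.
  split; last by apply/mxOverP => i j; have := hI i (lshift 1 j); rewrite row_mxEl.
  by have := hI 0 (rshift n 0); rewrite row_mxEr mxE.
by rewrite /hat mxE; case: (fintype.split j) => k; rewrite ?mxE.
Qed.

Local Open Scope classical_set_scope.
Local Open Scope ring_scope.

(** Indexed families, possibly with repetitions, let coefficients be functions on a finite type and
    let faces be predicates on the indices. *)
Definition points (T : Type) (I : finType) (A : pred I) (p : I -> T) : set T :=
  [set x | exists2 i, A i & x = p i].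

(** Convex and affine hulls are treated at once, [S] being nonnegativity or no condition.
    Coefficients of points that repeat a generator are added up, and the condition that they sum to
    1 becomes the height coordinate. *)
Lemma combination_points (R : realType) (n : nat) (S : R -> Prop) (I : finType)
    (A : pred I) (p : I -> 'rV[R]_n) (x : 'rV[R]_n) :
  S 0 -> (forall a b, S a -> S b -> S (a + b)) ->
  (exists (k : nat) (c : 'I_k -> R) (q : 'I_k -> 'rV[R]_n),
     [/\ forall i, points A p (q i), forall i, S (c i), \sum_i c i = 1
       & x = \sum_i c i *: q i]) <->
  (exists c : I -> R, (forall i, S (c i)) /\
     hat 1 x = \sum_(i | A i) c i *: hat 1 (p i)).
Proof.
move=> S0 SD; split=> [[k [c [q [qA Sc c1 ->]]]]|[c [Sc xE]]].
  have /choice[f hf] : forall i, exists j, A j /\ q i = p j.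
    by move=> i; have [j Aj qE] := qA i; exists j.
  exists (fun j => \sum_(i | f i == j) c i); split.
    by move=> j; apply: (big_ind S).
  rewrite hat_sum; congr hat.
    under [RHS]eq_bigr do rewrite mulr1.
    rewrite -c1 (partition_big f A) => [|i _]; first by [].
    by have [] := hf i.
  rewrite (partition_big f A) => [|i _]; last by have [] := hf i.
  apply: eq_bigr => j _; rewrite scaler_suml; apply: eq_bigr => i /eqP <-.
  by have [_ ->] := hf i.
move: xE; rewrite hat_sum => /hat_inj[c1 ->].
exists #|A|, (c \o enum_val), (p \o enum_val); split.
- by move=> i; exists (enum_val i) => //; exact: enum_valP.
- by move=> i; exact: Sc.
- rewrite c1 [RHS](big_enum_val (fun i => c i * 1)).
  by apply: eq_bigr => i _; rewrite mulr1.
- exact: (big_enum_val (fun i => c i *: p i)).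
Qed.

Lemma conv_hull_points (R : realType) (n : nat) (I : finType)
    (A : pred I) (p : I -> 'rV[R]_n) (x : 'rV[R]_n) :
  conv_hull (points A p) x <->
  (exists c : I -> R, (forall i, 0 <= c i) /\
     hat 1 x = \sum_(i | A i) c i *: hat 1 (p i)).
Proof.
by apply: (@combination_points R n (fun a => 0 <= a)) => // a b; exact: addr_ge0.
Qed.

Lemma aff_hull_points (R : realType) (n : nat) (I : finType)
    (A : pred I) (p : I -> 'rV[R]_n) (x : 'rV[R]_n) :
  aff_hull (points A p) x <-> (hat 1 x <= rowspan A (fun i => hat 1 (p i)))%MS.
Proof.
have H := @combination_points R n (fun=> True) I A p x Logic.I (fun _ _ _ _ => Logic.I).
split=> [[k [c [q [qA c1 xE]]]]|/rowspanP[c xE]].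
  have [|c' [_ E]] := H.1; first by exists k, c, q; split.
  by apply/rowspanP; exists c'.
by have [|k [c' [q [? ? ? ?]]]] := H.2; [exists c|exists k, c', q; split].
Qed.

Lemma sub_conv_hull (R : realType) (n : nat) (A : set 'rV[R]_n) :
  A `<=` conv_hull A.
Proof.
move=> x Ax; exists 1%N, (fun=> 1), (fun=> x); split=> //; rewrite big_ord1 //.
by rewrite scale1r.
Qed.

Lemma aff_hull_conv (R : realType) (n : nat) (I : finType)
    (A : pred I) (p : I -> 'rV[R]_n) (x : 'rV[R]_n) :
  aff_hull (conv_hull (points A p)) x <->
  (hat 1 x <= rowspan A (fun i => hat 1 (p i)))%MS.
Proof.
rewrite -aff_hull_points; split=> [[k [c [q [qA c1 ->]]]]|].
  apply/aff_hull_points.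
  have -> : hat 1 (\sum_i c i *: q i) = \sum_i c i *: hat 1 (q i).
    by rewrite hat_sum; under [in RHS]eq_bigr do rewrite mulr1; rewrite c1.
  apply: summx_sub => i _; apply: scalemx_sub.
  have /conv_hull_points[d [_ ->]] := qA i.
  by apply/rowspanP; exists d.
move=> [k [c [q [qA c1 xE]]]]; exists k, c, q; split=> // i.
exact: sub_conv_hull.
Qed.

Lemma rsubmx_hat (R : realType) (n : nat) (t : R) (p : 'rV[R]_n) :
  rsubmx (hat t p) 0 0 = t.
Proof. by rewrite /hat row_mxKr mxE. Qed.

Lemma rank_rowspan_free (F : fieldType) (n d : nat) (x : 'I_d -> 'rV[F]_n) :
  (forall c : 'I_d -> F, \sum_i c i *: x i = 0 -> forall i, c i = 0) ->
  \rank (rowspan predT x) = d.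
Proof.
move=> free; pose X := \matrix_i x i.
have XE : (rowspan predT x :=: X)%MS.
  apply/eqmxP; apply/andP; split.
    by apply: rowspan_subP => i _; rewrite -[x i](rowK x) row_sub.
  by apply/row_subP => i; rewrite rowK; exact: rowspan_sup.
rewrite XE; apply/eqP; apply: inj_row_free => v; rewrite mulmx_sum_row => vX.
apply/rowP => i; rewrite mxE; apply: (free (fun i => v 0 i)).
by rewrite -[RHS]vX; apply: eq_bigr => k _; rewrite rowK.
Qed.

(** The height is nonzero on [E], so its kernel has codimension one there. *)
Lemma rank_height (R : realType) (n : nat) (E : 'M[R]_(n + 1)) (x0 : 'rV[R]_n) :
  (hat 1 x0 <= E)%MS -> \rank E = (\rank (E :&: kermx (height R n))%MS).+1.
Proof.
move=> /submxP[t tE]; rewrite -(mxrank_mul_ker E (height R n)).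
suff -> : \rank (E *m height R n) = 1%N by [].
apply/eqP; rewrite eqn_leq rank_leq_col lt0n mxrank_eq0.
apply/eqP => E0; have /eqP := pairing_height 1 x0.
by rewrite /pairing tE -mulmxA E0 mulmx0 mxE eq_sym oner_eq0.
Qed.

Lemma sub_kermx_height (R : realType) (n : nat) (E : 'M[R]_(n + 1)) (g : 'rV[R]_(n + 1)) :
  (g <= E :&: kermx (height R n))%MS = (g <= E)%MS && (rsubmx g 0 0 == 0).
Proof.
rewrite sub_capmx; congr (_ && _); apply/sub_kermxP/eqP => [gh|g0].
  by rewrite -(pairing_height (rsubmx g 0 0) (lsubmx g)) -hatE /pairing gh mxE.
apply/matrixP => i j; rewrite !ord1 -/(pairing (height R n) g) {1}[g]hatE.
by rewrite pairing_height g0 mxE.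
Qed.

(** The height-zero part of the span of the cone is the direction space of the affine hull; the
    remaining dimension is the height. *)
Lemma has_dim_rank (R : realType) (n : nat) (I : finType) (A : pred I)
    (p : I -> 'rV[R]_n) (d : nat) :
  has_dim (conv_hull (points A p)) d <->
  \rank (rowspan A (fun i => hat 1 (p i))) = d.+1.
Proof.
set E := rowspan A _; pose K := (E :&: kermx (height R n))%MS.
have affE x : aff_hull (conv_hull (points A p)) x <-> (hat 1 x <= E)%MS.
  exact: aff_hull_conv.
have KE x : (hat 0 x <= K)%MS = (hat 0 x <= E)%MS.
  by rewrite sub_kermx_height rsubmx_hat eqxx andbT.
split=> [[x0 [U [<- aff]]]|rE].
  have affU x : (hat 1 x <= E)%MS <-> x - x0 \in U.
    by rewrite -affE aff.
  have x0E : (hat 1 x0 <= E)%MS by apply/affU; rewrite subrr mem0v.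
  rewrite (rank_height x0E); congr S.
  pose b (i : 'I_(\dim U)) := (vbasis U)`_i.
  have -> : \rank K = \rank (rowspan predT (fun i => hat 0 (b i))).
    apply: eqmx_rank; apply/andP; split.
      apply/rV_subP => g; rewrite [g]hatE; move: (rsubmx g 0 0) (lsubmx g) => t v.
      rewrite sub_kermx_height rsubmx_hat => /andP[+ /eqP t0]; rewrite {t}t0 => vE.
      have vU : v \in U.
        rewrite -[v](addrK x0); apply/affU; rewrite -[1]add0r -hatD.
        exact: addmx_sub.
      apply/rowspanP; exists (fun i => coord (vbasis U) i v).
      rewrite hat_sum {1}(coord_vbasis vU); congr hat.
      by rewrite big1 // => i _; rewrite mulr0.
    apply: rowspan_subP => i _; rewrite KE.
    have -> : hat 0 (b i) = hat 1 (b i + x0) - hat 1 x0 by rewrite hatB subrr addrK.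
    rewrite addmx_sub ?eqmx_opp //; apply/affU; rewrite addrK.
    by apply: vbasis_mem; apply: mem_nth; rewrite size_tuple.
  apply: rank_rowspan_free => c; rewrite hat_sum -(hat0 R n) => /hat_inj[_ cb].
  by apply/freeP: cb; apply: basis_free; exact: vbasisP.
have [i0 Ai0] : exists i, A i.
  apply: contrapT => no; have := mxrank0 R (n + 1) (n + 1).
  rewrite (_ : 0 = E) ?rE // /E /rowspan big_pred0 // => i.
  by apply/negP => Ai; apply: no; exists i.
pose x0 := p i0.
have x0E : (hat 1 x0 <= E)%MS by exact: (@rowspan_sup _ _ _ A (fun i => hat 1 (p i))).
have rK : \rank K = d by apply: succn_inj; rewrite -rE (rank_height x0E).
pose u (i : 'I_(\rank K)) := lsubmx (row i (row_base K)).
have uE i : row i (row_base K) = hat 0 (u i).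
  have : (row i (row_base K) <= K)%MS.
    by apply: submx_trans (row_sub _ _) _; rewrite eq_row_base.
  by rewrite sub_kermx_height => /andP[_ /eqP r0]; rewrite [LHS]hatE r0.
have [X Xu] : exists X : (\rank K).-tuple 'rV[R]_n, forall i : 'I_(\rank K), X`_i = u i.
  by exists [tuple u i | i < \rank K] => i; rewrite -tnth_nth tnth_mktuple.
exists x0, <<X>>%VS; split.
  have /eqP -> : free X; last by rewrite size_tuple.
  apply/freeP => c cX i.
  have /row_free_inj := row_base_free K => /(_ 1%N (\row_i c i) 0).
  rewrite mul0mx mulmx_sum_row => inj.
  have /rowP /(_ i) : \row_i c i = 0; last by rewrite !mxE.
  apply: inj; under eq_bigr do rewrite mxE uE.
  rewrite hat_sum big1 => [|k _]; last by rewrite mulr0.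
  rewrite -[RHS](hat0 R n); congr hat; rewrite -[RHS]cX.
  by apply: eq_bigr => k _; rewrite Xu.
apply/seteqP; split=> x /=.
  move=> /affE xE.
  have : (hat 0 (x - x0) <= row_base K)%MS.
    by rewrite eq_row_base KE -(subrr 1) -hatB addmx_sub ?eqmx_opp.
  move=> /submxP[c]; rewrite mulmx_sum_row => cE.
  have -> : x - x0 = \sum_i c 0 i *: u i.
    have : hat 0 (x - x0) = \sum_i c 0 i *: hat 0 (u i).
      by rewrite cE; apply: eq_bigr => i _; rewrite uE.
    by rewrite hat_sum => /hat_inj[].
  apply: memv_suml => i _; apply: memvZ; apply: memv_span.
  by rewrite -Xu; apply: mem_nth; rewrite size_tuple.
move=> /coord_span xE; apply/affE.
rewrite -[x](subrK x0) -[1]add0r -hatD addmx_sub //.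
rewrite -KE -(eq_row_base K) xE; apply/submxP.
exists (\row_i coord X i (x - x0)); rewrite mulmx_sum_row.
under [RHS]eq_bigr do rewrite mxE uE.
rewrite hat_sum; congr hat; last by apply: eq_bigr => i _; rewrite Xu.
by rewrite big1 // => k _; rewrite mulr0.
Qed.

Lemma conv_hullS (R : realType) (n : nat) (A B : set 'rV[R]_n) :
  A `<=` B -> conv_hull A `<=` conv_hull B.
Proof.
move=> AB x [k [c [q [qA c_ge0 c1 xE]]]]; exists k, c, q; split=> // i.
exact/AB/qA.
Qed.

Lemma pointsS (T : Type) (I : finType) (A B : pred I) (p : I -> T) :
  subpred A B -> points A p `<=` points B p.
Proof. by move=> AB x [i Ai ->]; exists i => //; exact: AB. Qed.

(** Only vertices are known to be integral, so a minimal generating subset is taken. A generator in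
    the cone over the others could be dropped; any other is separated from them by a functional
    whose minimum on [P] is attained at this generator alone, so it is a vertex. *)
Lemma lattice_polytope_points (R : realType) (n : nat) (P : set 'rV[R]_n) :
  lattice_polytope P -> exists (k : nat) (p : 'I_k -> 'rV[R]_n),
    P = conv_hull (points predT p) /\ forall i, p i \is a mxOver Num.int.
Proof.
move=> [[V /finite_seqP[s ->] PE] _ vI].
pose q (i : 'I_(size s)) := s`_i.
have {}PE : P = conv_hull (points [in [set: 'I_(size s)]%SET] q).
  rewrite PE; congr conv_hull; apply/seteqP; split=> x /=.
    move=> xs; have xi : (index x s < size s)%N by rewrite index_mem.
    by exists (Ordinal xi); rewrite ?inE // /q nth_index.
  by move=> [i _ ->]; apply: mem_nth.
pose Q (A : {set 'I_(size s)}) := `[< P = conv_hull (points [in A] q) >].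
have [|A /minsetP[/asboolP PA minA]] := @ex_minset _ Q.
  by exists [set: 'I_(size s)]%SET; apply/asboolP.
suff qI i : i \in A -> q i \is a mxOver Num.int.
  exists #|A|, (q \o enum_val); split; last by move=> i; apply/qI/enum_valP.
  rewrite PA; congr conv_hull; apply/seteqP; split=> _ [i iA ->].
    by exists (enum_rank_in iA i); rewrite //= enum_rankK_in.
  by exists (enum_val i) => //; exact: enum_valP.
move=> iA; apply: vI; pose A' := (A :\ i)%SET.
have splitA (V' : nmodType) (f : 'I_(size s) -> V') :
    (\sum_(j in A) f j = f i + \sum_(j in A') f j)%R.
  by rewrite (big_setD1 i).
pose x j := if j \in A' then hat 1 (q j) else 0.
have sumx c : (\sum_j c j *: x j = \sum_(j in A') c j *: hat 1 (q j))%R.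
  rewrite [RHS]big_mkcond; apply: eq_bigr => j _; rewrite /x.
  by case: ifP => _ //; rewrite scaler0.
have [[c [c_ge0]]|[u [u_ge0 ui]]] := farkas x (hat 1 (q i)).
  rewrite sumx => qiE; suff A'E : A' = A.
    by have := iA; rewrite -A'E !inE eqxx.
  apply: minA; last exact: finset.subD1set.
  apply/asboolP; rewrite PA; apply/seteqP; split; last first.
    by apply/conv_hullS/pointsS => j; rewrite inE => /andP[].
  move=> z /conv_hull_points[d [d_ge0 zE]]; apply/conv_hull_points.
  exists (fun j => d i * c j + d j); split.
    by move=> j; rewrite addr_ge0 // mulr_ge0.
  rewrite zE splitA qiE scaler_sumr -big_split /=; apply: eq_bigr => j _.
  by rewrite scalerDl scalerA.
have {}u_ge0 j : j \in A' -> 0 <= pairing u (hat 1 (q j)).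
  by move=> jA; have := u_ge0 j; rewrite /x jA.
pose u1 := (- 1) *: usubmx u.
have uE z : pairing u1 z = dsubmx u 0 0 - pairing u (hat 1 z).
  by rewrite {2}(cV_hatE u) pairing_hat pairingZl; ring.
have key z : P z -> exists d : 'I_(size s) -> R, [/\ forall j, 0 <= d j,
    d i <= 1, d i = 1 -> z = q i &
    d i * pairing u (hat 1 (q i)) <= pairing u (hat 1 z)].
  rewrite PA => /conv_hull_points[d [d_ge0 zE]]; exists d.
  have := zE; rewrite hat_sum => /hat_inj[]; under eq_bigr do rewrite mulr1.
  rewrite !splitA => d1 zqE.
  have rest_ge0 : 0 <= \sum_(j in A') d j by apply: sumr_ge0.
  split=> //; first by rewrite d1 lerDl.
    move=> di; move: d1; rewrite di => /eqP.
    rewrite -subr_eq0 opprD addrA subrr sub0r oppr_eq0 => /eqP.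
    move=> /(psumr_eq0P (fun j _ => d_ge0 j)) d0.
    by rewrite zqE di scale1r big1 ?addr0 // => j jA; rewrite d0 // scale0r.
  rewrite zE splitA pairingD pairingZ lerDl pairing_sumZ sumr_ge0 // => j jA.
  by rewrite mulr_ge0 // u_ge0.
exists u1, (pairing u1 (q i)); split=> [z Pz|].
  have [d [d_ge0 d_le1 _ dz]] := key z Pz; rewrite !uE; nra.
apply/seteqP; split=> z /=.
  move=> ->; split=> //; rewrite PA; apply: sub_conv_hull.
  by exists i.
move=> [Pz uz]; have [d [d_ge0 d_le1 dq dz]] := key z Pz; apply: dq.
by move: uz; rewrite !uE; nra.
Qed.

Lemma aff_hull_dilate (R : realType) (n r : nat) (P : set 'rV[R]_n) (z : 'rV[R]_n) :
  (0 < r)%N -> aff_hull (dilate r P) z <-> aff_hull P (r%:R^-1 *: z).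
Proof.
move=> r_gt0; have r0 : r%:R != 0 :> R by rewrite pnatr_eq0 -lt0n.
split=> [[k [c [q [qP c1 ->]]]]|[k [c [q [qP c1 zE]]]]].
  have /choice[q' hq'] : forall i, exists w, P w /\ r%:R *: w = q i.
    by move=> i; have [w Pw wE] := qP i; exists w.
  exists k, c, q'; split=> // [i|]; first by have [] := hq' i.
  rewrite scaler_sumr; apply: eq_bigr => i _.
  by have [_ <-] := hq' i; rewrite !scalerA mulrCA mulVf // mulr1.
exists k, c, (fun i => r%:R *: q i); split=> // [i|]; first by exists (q i).
transitivity (r%:R *: (r%:R^-1 *: z)); first by rewrite scalerA divff // scale1r.
rewrite zE scaler_sumr.
by apply: eq_bigr => i _; rewrite !scalerA mulrC.
Qed.

Lemma has_dim_dilate (R : realType) (n r d : nat) (P : set 'rV[R]_n) :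
  (0 < r)%N -> has_dim P d -> has_dim (dilate r P) d.
Proof.
move=> r_gt0 [x0 [U [dU aff]]]; exists (r%:R *: x0), U; split=> //.
have r0 : r%:R != 0 :> R by rewrite pnatr_eq0 -lt0n.
have affE z : aff_hull P z <-> z - x0 \in U by rewrite aff.
apply/seteqP; split=> z /=.
  move=> /(aff_hull_dilate _ _ r_gt0) /affE zU.
  rewrite (_ : z - _ = r%:R *: (r%:R^-1 *: z - x0)) ?memvZ //.
  by rewrite scalerBr scalerA divff // scale1r.
move=> zU; apply/(aff_hull_dilate _ _ r_gt0)/affE.
rewrite (_ : _ - x0 = r%:R^-1 *: (z - r%:R *: x0)) ?memvZ //.
by rewrite scalerBr scalerA mulVf // scale1r.
Qed.

Lemma dilate_conv_points (R : realType) (n r : nat) (I : finType) (A : pred I)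
    (p : I -> 'rV[R]_n) (z : 'rV[R]_n) : (0 < r)%N ->
  dilate r (conv_hull (points A p)) z <->
  (exists c : I -> R, (forall i, 0 <= c i) /\
     hat r%:R z = \sum_(i | A i) c i *: hat 1 (p i)).
Proof.
move=> r_gt0; have r0 : r%:R != 0 :> R by rewrite pnatr_eq0 -lt0n.
split=> [[w /conv_hull_points[c [c_ge0 wE]] <-]|[c [c_ge0 zE]]].
  exists (fun i => r%:R * c i); split; first by move=> i; rewrite mulr_ge0.
  rewrite -[X in hat X]mulr1 -hatZ wE scaler_sumr.
  by apply: eq_bigr => i _; rewrite scalerA.
exists (r%:R^-1 *: z); last by rewrite scalerA divff // scale1r.
apply/conv_hull_points; exists (fun i => r%:R^-1 * c i); split.
  by move=> i; rewrite mulr_ge0 // invr_ge0.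
have -> : hat 1 (r%:R^-1 *: z) = r%:R^-1 *: hat r%:R z by rewrite hatZ mulVf.
by rewrite zE scaler_sumr; apply: eq_bigr => i _; rewrite scalerA.
Qed.

Lemma aff_hull_dilate_points (R : realType) (n r : nat) (I : finType) (A : pred I)
    (p : I -> 'rV[R]_n) (z : 'rV[R]_n) : (0 < r)%N ->
  aff_hull (dilate r (conv_hull (points A p))) z <->
  (hat r%:R z <= rowspan A (fun i => hat 1%R (p i)))%MS.
Proof.
move=> r_gt0; have r0 : r%:R != 0 :> R by rewrite pnatr_eq0 -lt0n.
rewrite aff_hull_dilate // aff_hull_conv.
have -> : hat 1 (r%:R^-1 *: z) = r%:R^-1 *: hat r%:R z by rewrite hatZ mulVf.
by rewrite eqmx_scale // invr_eq0.
Qed.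

(** * From reflexive polytopes to integral facet functionals *)

(** Functionals on [E] that vanish on the hyperplane [Z] form a line, and the value at [m] fixes the
    scalar. *)
Lemma functional_proportional (R : realType) (n : nat) (E Z : 'M[R]_n)
    (f g : 'cV[R]_n) (m : 'rV[R]_n) :
  (Z <= E)%MS -> \rank E = (\rank Z).+1 -> (m <= E)%MS -> pairing g m = 1 ->
  (forall z : 'rV[R]_n, (z <= Z)%MS -> pairing f z = 0 /\ pairing g z = 0) ->
  forall v : 'rV[R]_n, (v <= E)%MS -> pairing f v = pairing f m * pairing g v.
Proof.
move=> ZE rE mE gm fg v vE.
have ZmE : (Z + <<m>> <= E)%MS by rewrite addsmx_sub ZE genmxE.
have EZm : (E <= Z + <<m>>)%MS.
  rewrite -(mxrank_leqif_sup ZmE) eqn_leq mxrankS //= rE.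
  apply: rank_ltmx; rewrite ltmxE addsmxSl; apply/negP => /(submx_trans _) h.
  have /fg[_ /eqP] : (m <= Z)%MS.
    by apply: h; apply: submx_trans (addsmxSr _ _); rewrite genmxE.
  by rewrite gm oner_eq0.
have /sub_addsmxP[[a b] /= ->] := submx_trans vE EZm.
have [fa ga] := fg _ (submxMl a Z).
have /sub_rVP[c ->] : (b *m <<m>>%MS <= m)%MS.
  by apply: submx_trans (submxMl _ _) _; rewrite genmxE.
by rewrite !pairingD fa ga !add0r !pairingZ gm mulr1 mulrC.
Qed.

Lemma near_normP (R : realType) (n : nat) (m : 'rV[R]_n) (Q : 'rV[R]_n -> Prop) :
  (\forall x \near m, Q x) <->
  (exists2 e : R, 0 < e & forall x, `|x - m| < e -> Q x).
Proof.
split=> [/nbhs_normP[e /= e_gt0 he]|[e e_gt0 he]].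
  by exists e => // x xm; apply: he; rewrite /ball_ /= distrC.
apply/nbhs_normP; exists e => //= x; rewrite /ball_ /= distrC.
exact: he.
Qed.

(** Move from [m] slightly away from [s] times the sum of all generators, [s = r / k] placing that
    point at height [r]. The moved point is still in the polytope, and [m] is an average of it with
    a point all of whose coefficients are positive. *)
Lemma rel_interior_positive (R : realType) (n k r : nat) (p : 'I_k -> 'rV[R]_n)
    (m : 'rV[R]_n) : (0 < r)%N ->
  rel_interior (dilate r (conv_hull (points predT p))) m ->
  exists al : 'I_k -> R, (forall i, 0 < al i) /\
    hat r%:R m = \sum_i al i *: hat 1 (p i).
Proof.
move=> r_gt0 [/(dilate_conv_points _ _ _ r_gt0)[c [_ mE]]].
move=> /near_normP[e e_gt0 near_m].
have rR_gt0 : 0 < r%:R :> R by rewrite ltr0n.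
have k_gt0 : 0 < k%:R :> R.
  rewrite ltr0n lt0n; apply: contraTneq rR_gt0 => k0.
  move: mE; rewrite hat_sum big1 => [|i _]; last first.
    by suff : (i < 0)%N by []; rewrite -k0 ltn_ord.
  by move=> /hat_inj[-> _]; rewrite ltxx.
pose s := r%:R / k%:R : R.
have s_gt0 : 0 < s by rewrite divr_gt0.
pose w := m - s *: \sum_i p i.
pose d := e / (1 + `|w|) / 2.
have w1 : 0 < 1 + `|w| by rewrite ltr_pwDl.
have d_gt0 : 0 < d by rewrite !divr_gt0.
have cE : hat k%:R (\sum_i p i) = \sum_i 1 *: hat 1 (p i).
  rewrite hat_sum; congr hat; last by apply: eq_bigr => i _; rewrite scale1r.
  by under eq_bigr do rewrite mulr1; rewrite sumr_const card_ord.
have zE : hat r%:R (m + d *: w) =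
    (1 + d) *: hat r%:R m - (d * s) *: hat k%:R (\sum_i p i).
  rewrite !hatZ hatB; congr hat; last by rewrite /w scalerBr scalerDl scale1r addrA scalerA.
  by rewrite /s; field; rewrite gt_eqF.
have [|b [b_ge0 bE]] := (dilate_conv_points predT p (m + d *: w) r_gt0).1.
  apply: near_m.
    rewrite addrAC subrr add0r normrZ gtr0_norm //.
    have dE : d * (1 + `|w|) = e / 2 by rewrite /d; field; rewrite gt_eqF.
    by move: dE; rewrite mulrDr mulr1; lra.
  apply/(aff_hull_dilate_points _ _ _ r_gt0); rewrite zE cE mE.
  apply/rowspanP; exists (fun i => (1 + d) * c i - d * s).
  rewrite !scaler_sumr -sumrB; apply: eq_bigr => i _.
  by rewrite !scalerA scalerBl mulr1.
exists (fun i => (b i + d * s) / (1 + d)); split=> [i|].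
  have d1_gt0 : 0 < 1 + d by rewrite addr_gt0.
  by rewrite divr_gt0 // ltr_wpDl // mulr_gt0.
have d1 : 1 + d != 0 by rewrite gt_eqF // addr_gt0.
have -> : hat r%:R m =
    (1 + d)^-1 *: (hat r%:R (m + d *: w) + (d * s) *: hat k%:R (\sum_i p i)).
  by rewrite zE subrK scalerA mulVf // scale1r.
rewrite bE cE !scaler_sumr -big_split /= scaler_sumr; apply: eq_bigr => i _.
by rewrite scalerA mulr1 -scalerDl scalerA mulrC.
Qed.

(** The functional [w] that reflexivity gives for the facet is constant there, so subtracting it
    from its facet value and homogenizing yields a [y] that vanishes over the facet. Lattice
    distance one becomes value 1 at the interior point. *)
Lemma facet_functional (R : realType) (n k r d : nat) (p : 'I_k -> 'rV[R]_n)
    (m : 'rV[R]_n) (u : 'cV[R]_(n + 1)) :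
  let P := conv_hull (points predT p) in
  let x i := hat 1 (p i) in
  let Z := rowspan (fun i => pairing u (x i) == 0) x in
  (0 < r)%N -> (forall i, p i \is a mxOver Num.int) ->
  (forall F, facet (dilate r P) F -> exists w, integral_functional (dilate r P) w /\
     forall f, F f -> pairing w f - pairing w m = 1) ->
  \rank (rowspan predT x) = d.+2 -> \rank Z = d.+1 ->
  (forall i, 0 <= pairing u (x i)) ->
  exists y : 'cV[R]_(n + 1),
  [/\ forall g, (g <= rowspan predT x)%MS -> g \is a mxOver Num.int ->
        pairing y g \is a Num.int,
      pairing y (hat r%:R m) = 1
    & forall z : 'rV[R]_(n + 1), (z <= Z)%MS -> pairing y z = 0].
Proof.
move=> P x Z r_gt0 pI facets rE rZ u_ge0.
have r0 : r%:R != 0 :> R by rewrite pnatr_eq0 -lt0n.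
pose A : pred 'I_k := fun i => pairing u (x i) == 0.
pose F := dilate r P `&`
  [set z | pairing (- 1 *: usubmx u) z = r%:R * dsubmx u 0 0].
have uE z : pairing u (hat r%:R z) =
    r%:R * dsubmx u 0 0 - pairing (- 1 *: usubmx u) z.
  by rewrite {1}(cV_hatE u) pairing_hat pairingZl; ring.
have FE : F = dilate r (conv_hull (points A p)).
  apply/seteqP; split=> z.
    move=> [/(dilate_conv_points _ _ _ r_gt0)[c [c_ge0 zE]] /= uz].
    have : pairing u (hat r%:R z) = 0 by rewrite uE uz subrr.
    rewrite zE pairing_sumZ.
    move=> /(psumr_eq0P (fun i _ => mulr_ge0 (c_ge0 i) (u_ge0 i))) cu.
    apply/(dilate_conv_points _ _ _ r_gt0); exists c; split=> //.
    rewrite zE [RHS]big_mkcond; apply: eq_bigr => i _; rewrite /A.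
    case: ifPn => // ui; have /eqP := cu i isT.
    by rewrite mulf_eq0 (negbTE ui) orbF => /eqP ->; rewrite scale0r.
  move=> /(dilate_conv_points _ _ _ r_gt0)[c [c_ge0 zE]]; split.
    apply/(dilate_conv_points _ _ _ r_gt0).
    exists (fun i => if A i then c i else 0); split=> [i|]; first by case: ifP.
    by rewrite zE big_mkcond; apply: eq_bigr => i _; case: ifP; rewrite ?scale0r.
  apply/eqP; rewrite eq_sym -subr_eq0 -uE zE pairing_sumZ big1 // => i /eqP ->.
  by rewrite mulr0.
have /facets[w [wI wF]] : facet (dilate r P) F.
  split.
    exists (- 1 *: usubmx u), (r%:R * dsubmx u 0 0); split=> // z.
    move=> /(dilate_conv_points _ _ _ r_gt0)[c [c_ge0 zE]].
    rewrite -subr_ge0 -uE zE pairing_sumZ sumr_ge0 // => i _.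
    by rewrite mulr_ge0 //; exact: u_ge0.
  exists d; rewrite FE; split; apply: has_dim_dilate => //;
    by apply/has_dim_rank.
have [i0 Ai0] : exists i, A i.
  apply: contrapT => no; move: rZ; rewrite /Z /rowspan big_pred0 ?mxrank0 //.
  by move=> i; apply/negP => Ai; apply: no; exists i.
have Fi i : A i -> F (r%:R *: p i).
  move=> Ai; rewrite FE; exists (p i) => //; apply: sub_conv_hull.
  by exists i.
pose y : 'cV[R]_(n + 1) := col_mx (- 1 *: w) (const_mx (pairing w (p i0))).
have yE t z : pairing y (hat t z) = t * pairing w (p i0) - pairing w z.
  by rewrite pairing_hat pairingZl; ring.
exists y; split=> [g gE||].
- move: gE; rewrite [g]hatE int_hat; move: (rsubmx g 0 0) (lsubmx g) => t q qE.
  move=> /andP[tI qI]; rewrite yE -pairingZ -pairingB.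
  have xE : (x i0 <= rowspan predT x)%MS by exact: rowspan_sup.
  have rI : (r%:R : R) \is a Num.int by rewrite natr_int.
  (* The constant [pairing w (p i0)] need not be an integer, and [w] is integral only on differences
     of lattice points of the affine hull of the dilate; the vector is rewritten as such a
     difference. *)
  have -> : t *: p i0 - q = r%:R *: p i0 - (r%:R *: p i0 + q - t *: p i0).
    by rewrite !opprD opprK !addrA subrr add0r addrC.
  have rpE : hat r%:R (r%:R *: p i0) = r%:R *: x i0 by rewrite hatZ mulr1.
  apply: wI; split; rewrite /= ?int_mxB ?int_mxD ?int_mxZ //;
    apply/(aff_hull_dilate_points _ _ _ r_gt0).
    by rewrite rpE scalemx_sub.
  have -> : hat r%:R (r%:R *: p i0 + q - t *: p i0) = r%:R *: x i0 + hat t q - t *: x i0.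
    by rewrite !hatZ hatD hatB !mulr1 addrK.
  by rewrite !addmx_sub ?eqmx_opp ?scalemx_sub.
- by rewrite yE -pairingZ; apply: wF; exact: Fi.
move=> z; apply: pairing_rowspan => i Ai; rewrite yE mul1r.
have := wF _ (Fi i Ai); have := wF _ (Fi i0 Ai0); rewrite !pairingZ => e0 e1.
by apply: (mulfI r0); rewrite mulrBr mulr0; lra.
Qed.

Lemma reflexive_cone_data (R : realType) (n k r d : nat) (p : 'I_k -> 'rV[R]_n) :
  let P := conv_hull (points predT p) in
  let x i := hat 1 (p i) in
  (0 < r)%N -> (forall i, p i \is a mxOver Num.int) ->
  has_dim P d.+1 -> reflexive_polytope (dilate r P) ->
  exists (J : finType) (y : J -> 'cV[R]_(n + 1)) (al : 'I_k -> R) (m : 'rV[R]_n),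
  [/\ m \is a mxOver Num.int,
      (forall i, 0 < al i) /\ hat r%:R m = \sum_i al i *: x i,
      forall j g, (g <= rowspan predT x)%MS -> g \is a mxOver Num.int ->
        pairing (y j) g \is a Num.int,
      (forall i j, 0 <= pairing (y j) (x i)) /\
        (forall j, pairing (y j) (hat r%:R m) = 1)
    & forall u, (forall i, 0 <= pairing u (x i)) ->
        exists c : J -> R, (forall j, 0 <= c j) /\
          forall i, pairing u (x i) = \sum_j c j * pairing (y j) (x i)].
Proof.
move=> P x r_gt0 pI /has_dim_rank; rewrite -/x => rE [_ [m [mint mI facets]]].
have [al [al_gt0 mE]] := rel_interior_positive r_gt0 mint.
have memE : (hat r%:R m <= rowspan predT x)%MS.
  by rewrite mE; apply/rowspanP; exists al.
pose Z (u : 'cV[R]_(n + 1)) : {set 'I_k} := [set i | pairing u (x i) == 0]%SET.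
pose sp (A : {set 'I_k}) := rowspan [in A] x.
have spZ u : sp (Z u) = rowspan (fun i => pairing u (x i) == 0) x.
  by apply: eq_rowspan => // i /=; rewrite inE.
pose is_facet A := `[< exists u, [/\ forall i, 0 <= pairing u (x i), A = Z u
  & \rank (sp A) = d.+1] >].
(* Facets are indexed by the sets of generators they contain, which makes the index type finite. *)
pose J := {A : {set 'I_k} | is_facet A}.
(* On the span, a functional supporting a facet is its value at the interior point times [y]. As
   this value is positive, [y] inherits nonnegativity, and violated facets are detected by some
   [y]. *)
have prop u f : \rank (sp (Z u)) = d.+1 -> pairing f (hat r%:R m) = 1 ->
    (forall z : 'rV[R]_(n + 1), (z <= sp (Z u))%MS -> pairing f z = 0) ->
    forall v : 'rV[R]_(n + 1), (v <= rowspan predT x)%MS ->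
      pairing u v = pairing u (hat r%:R m) * pairing f v.
  move=> rZ fm fZ; apply: (@functional_proportional _ _ _ (sp (Z u))) => //.
  - by apply: rowspan_subP => i _; exact: rowspan_sup.
  - by rewrite rE rZ.
  - move=> z zZ; split; last exact: fZ.
    by apply: pairing_rowspan zZ => i /=; rewrite inE => /eqP.
have um_gt0 u : (forall i, 0 <= pairing u (x i)) -> \rank (sp (Z u)) = d.+1 ->
    0 < pairing u (hat r%:R m).
  move=> u_ge0 rZ; have au_ge0 i : true -> 0 <= al i * pairing u (x i).
    by move=> _; rewrite mulr_ge0 // ltW.
  rewrite lt_neqAle eq_sym mE pairing_sumZ sumr_ge0 // andbT.
  apply/eqP => /(psumr_eq0P au_ge0) u0.
  have : sp (Z u) = rowspan predT x.
    apply: eq_rowspan => // i /=; rewrite !inE; apply/eqP.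
    by have /eqP := u0 i isT; rewrite mulf_eq0 gt_eqF //= => /eqP.
  by move=> /(congr1 mxrank); rewrite rZ rE; lia.
have /choice[y hy] : forall A : J, exists y : 'cV[R]_(n + 1),
  [/\ forall g, (g <= rowspan predT x)%MS -> g \is a mxOver Num.int ->
        pairing y g \is a Num.int,
      pairing y (hat r%:R m) = 1
    & forall z : 'rV[R]_(n + 1), (z <= sp (val A))%MS -> pairing y z = 0].
  move=> [A /= /asboolP[u [u_ge0 -> rZ]]]; rewrite spZ.
  rewrite spZ in rZ.
  exact: (facet_functional r_gt0 pI facets rE rZ u_ge0).
exists J, y, al, m; split=> //.
- by move=> A; have [] := hy A.
- split; last by move=> A; have [] := hy A.
  move=> i A; have [_ ym yZ] := hy A.
  have /asboolP[u [u_ge0 AE rZ]] := valP A; rewrite AE in rZ yZ.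
  have := u_ge0 i; rewrite (prop u (y A)) ?rowspan_sup //.
  by rewrite pmulr_rge0 // um_gt0.
move=> u u_ge0; apply: dual_farkas => v vE yv.
suff : exists c : 'I_k -> R, (forall i, 0 <= c i) /\ v = \sum_i c i *: x i.
  move=> [c [c_ge0 ->]]; rewrite pairing_sumZ sumr_ge0 // => i _.
  by rewrite mulr_ge0.
apply: contrapT => /(facet_separation vE)[f [f_ge0 fv rf]].
have rZ : \rank (sp (Z f)) = d.+1 by apply: succn_inj; rewrite -rE rf spZ.
have fA : is_facet (Z f) by apply/asboolP; exists f; split.
have [_ ym yZ] := hy (exist _ (Z f) fA).
move: fv; rewrite (prop f (y (exist _ (Z f) fA))) //.
by rewrite pmulr_rlt0 ?um_gt0 // ltNge yv.
Qed.

Lemma dilate_points (R : realType) (n r : nat) (I : finType) (A : pred I)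
    (p : I -> 'rV[R]_n) : (0 < r)%N ->
  dilate r (conv_hull (points A p)) = conv_hull (points A (fun i => r%:R *: p i)).
Proof.
move=> r_gt0; have r0 : r%:R != 0 :> R by rewrite pnatr_eq0 -lt0n.
apply/seteqP; split=> z.
  move=> /(dilate_conv_points _ _ _ r_gt0)[c [c_ge0]]; rewrite hat_sum.
  under eq_bigr do rewrite mulr1; move=> /hat_inj[rc zE].
  apply/conv_hull_points; exists (fun i => r%:R^-1 * c i); split.
    by move=> i; rewrite mulr_ge0 // invr_ge0.
  rewrite hat_sum zE; congr hat.
    by under eq_bigr do rewrite mulr1; rewrite -mulr_sumr -rc mulVf.
  by apply: eq_bigr => i _; rewrite scalerA mulrAC mulVf // mul1r.
move=> /conv_hull_points[c [c_ge0]]; rewrite hat_sum.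
under eq_bigr do rewrite mulr1; move=> /hat_inj[c1 zE].
apply/(dilate_conv_points _ _ _ r_gt0); exists (fun i => r%:R * c i); split.
  by move=> i; rewrite mulr_ge0.
rewrite hat_sum zE; congr hat.
  by under eq_bigr do rewrite mulr1; rewrite -mulr_sumr -c1 mulr1.
by apply: eq_bigr => i _; rewrite scalerA mulrC.
Qed.

Lemma lattice_polytope_conv (R : realType) (n : nat) (I : finType) (A : pred I)
    (p : I -> 'rV[R]_n) :
  (exists i, A i) -> (forall i, A i -> p i \is a mxOver Num.int) ->
  lattice_polytope (conv_hull (points A p)).
Proof.
move=> [i0 Ai0] pI; split.
- exists (points A p) => //.
  rewrite (_ : points A p = p @` [set i | A i]); first exact: finite_image.
  by apply/seteqP; split=> x [i Ai xE]; exists i.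
- by exists (p i0); apply: sub_conv_hull; exists i0.
move=> v [u [b [ub vE]]].
have [] : (conv_hull (points A p) `&` [set x | pairing u x = b]) v by rewrite -vE.
move=> /conv_hull_points[c [c_ge0]]; rewrite hat_sum.
under eq_bigr do rewrite mulr1; move=> /hat_inj[c1 {}vE'] /= uv.
have pP i : A i -> conv_hull (points A p) (p i).
  by move=> Ai; apply: sub_conv_hull; exists i.
have slack_ge0 i : A i -> 0 <= c i * (b - pairing u (p i)).
  by move=> Ai; rewrite mulr_ge0 // subr_ge0 ub //; exact: pP.
have : \sum_(i | A i) c i * (b - pairing u (p i)) = 0.
  under eq_bigr do rewrite mulrBr.
  by rewrite sumrB -mulr_suml -c1 mul1r -pairing_sumZ -vE' uv subrr.
move=> /(psumr_eq0P slack_ge0) slack0.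
have [i Ai ci] : exists2 i, A i & c i != 0.
  apply: contrapT => no; have /eqP := c1; rewrite big1 ?oner_eq0 // => i Ai.
  by apply: contrapT => /eqP ci; apply: no; exists i.
have /eqP := slack0 i Ai; rewrite mulf_eq0 (negbTE ci) subr_eq0 eq_sym => /eqP ui.
have : [set v] (p i) by rewrite vE; split=> //; exact: pP.
by move=> /= <-; exact: pI.
Qed.

Lemma pairing_small (R : realType) (n : nat) (u : 'cV[R]_n) :
  exists2 e : R, 0 < e & forall w, `|w| < e -> `|pairing u w| < 1.
Proof.
pose C := 1 + \sum_i `|u i 0|.
have C_gt0 : 0 < C by rewrite ltr_pwDl // sumr_ge0.
exists C^-1; rewrite ?invr_gt0 // => w; rewrite -[C^-1]div1r ltr_pdivlMr //.
apply: le_lt_trans; rewrite /pairing mxE; apply: le_trans (ler_norm_sum _ _ _) _.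
rewrite /C mulrDr mulr1 mulr_sumr ler_wpDl // ler_sum // => i _.
rewrite normrM ler_wpM2r //.
rewrite [leRHS]/Num.norm /= mx_normrE.
exact: (le_bigmax _ (fun ij => `|w ij.1 ij.2|) (0, i)).
Qed.

(** A supporting functional of a facet is a nonnegative combination of the [y j]; one that occurs
    with nonzero coefficient must vanish on the facet, and its value 1 at height [r] over [m] is
    lattice distance one. *)
Lemma gorenstein_criterion (R : realType) (n r : nat) (I J : finType)
    (A : pred I) (B : pred J) (q : I -> 'rV[R]_n) (y : J -> 'cV[R]_(n + 1))
    (m : 'rV[R]_n) :
  (0 < r)%N -> (exists i, A i) -> (forall i, A i -> q i \is a mxOver Num.int) ->
  \rank (rowspan A (fun i => hat 1 (q i))) = n.+1 -> m \is a mxOver Num.int ->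
  (forall j g, B j -> g \is a mxOver Num.int -> pairing (y j) g \is a Num.int) ->
  (forall j, B j -> pairing (y j) (hat r%:R m) = 1) ->
  (forall u, (forall i, A i -> 0 <= pairing u (hat 1 (q i))) ->
     exists c : J -> R, (forall j, 0 <= c j) /\
       forall v, pairing u v = \sum_(j | B j) c j * pairing (y j) v) ->
  (forall i j, A i -> B j -> 0 <= pairing (y j) (hat 1 (q i))) ->
  gorenstein (conv_hull (points A q)) /\ has_dim (conv_hull (points A q)) n.
Proof.
move=> r_gt0 Ane qI rA mI yI ym cone y_ge0; set Q := conv_hull _.
have r0 : r%:R != 0 :> R by rewrite pnatr_eq0 -lt0n.
have dimQ : has_dim Q n by apply/has_dim_rank.
have y0E j z : pairing (y j) (hat 0 z) = pairing (usubmx (y j)) z.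
  by rewrite {1}[y j]cV_hatE pairing_hat mul0r addr0.
split=> //; split; first exact: lattice_polytope_conv.
have rQE : dilate r Q = conv_hull (points A (fun i => r%:R *: q i)).
  exact: dilate_points.
exists r; split=> //; split.
  rewrite rQE; apply: lattice_polytope_conv => // i Ai.
  by rewrite int_mxZ ?natr_int ?qI.
have in_rQ z : (forall j, B j -> 0 <= pairing (y j) (hat r%:R z)) -> dilate r Q z.
  move=> yz; apply/(dilate_conv_points _ _ _ r_gt0).
  pose x i := if A i then hat 1 (q i) else 0.
  have sumx c : \sum_i c i *: x i = \sum_(i | A i) c i *: hat 1 (q i).
    rewrite [RHS]big_mkcond; apply: eq_bigr => i _; rewrite /x.
    by case: ifP => _ //; rewrite scaler0.
  have [[c [c_ge0 zE]]|[u [u_ge0 uz]]] := farkas x (hat r%:R z).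
    by exists c; rewrite -sumx.
  have [i Ai|c [c_ge0 uE]] := cone u; first by have := u_ge0 i; rewrite /x Ai.
  move: uz; rewrite uE ltNge sumr_ge0 // => j Bj.
  by rewrite mulr_ge0 // yz.
exists m; split=> //.
  split; first by apply: in_rQ => j Bj; rewrite ym.
  (* All [y j] in [B] equal 1 at [m], so a displacement that changes each of them by less than 1
     stays in the dilate. *)
  have /choice[e he] : forall j, exists e : R, 0 < e /\
      forall w, `|w| < e -> `|pairing (usubmx (y j)) w| < 1.
    by move=> j; have [e e_gt0 he] := pairing_small (usubmx (y j)); exists e.
  have [j|e0 e0_gt0 he0] := @pos_lower_bound R J e; first by have [] := he j.
  apply/near_normP; exists e0 => // z zm _; apply: in_rQ => j Bj.
  have [_ /(_ (z - m))] := he j; rewrite (lt_le_trans zm (he0 j)) => /(_ isT).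
  rewrite ltr_norml => /andP[+ _].
  have -> : hat r%:R z = hat r%:R m + hat 0 (z - m) by rewrite hatD addr0 addrC subrK.
  by rewrite pairingD ym // y0E; lra.
move=> F [[u [b [ub FE]]] [d [dQ dF]]].
pose u' : 'cV[R]_(n + 1) := col_mx (- 1 *: u) (const_mx (r%:R^-1 * b)).
have u'E z : pairing u' (hat r%:R z) = b - pairing u z.
  by rewrite pairing_hat pairingZl mulrA divff //; ring.
have [i Ai|c [c_ge0 cE]] := cone u'.
  rewrite -(@pmulr_rge0 _ r%:R) ?ltr0n // -pairingZ hatZ mulr1 u'E subr_ge0.
  by apply: ub; rewrite rQE; apply: sub_conv_hull; exists i.
(* If all coefficients over [B] vanished, the facet would be the whole dilate, against its
   dimension. *)
have [j Bj cj] : exists2 j, B j & c j != 0.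
  apply: contrapT => no.
  have u'0 v : pairing u' v = 0.
    rewrite cE big1 // => j Bj; have [->|cj] := eqVneq (c j) 0; first by rewrite mul0r.
    by case: no; exists j.
  have FQ : F = dilate r Q.
    rewrite FE; apply/seteqP; split=> z; first by case.
    move=> zQ; split=> //=; apply/eqP; rewrite eq_sym -subr_eq0 -u'E.
    by rewrite u'0.
  move: dQ dF; rewrite FQ rQE => /has_dim_rank e1 /has_dim_rank; rewrite e1; lia.
have yF f : F f -> pairing (y j) (hat r%:R f) = 0.
  rewrite FE => -[/(dilate_conv_points _ _ _ r_gt0)[a [a_ge0 fE]] /= uf].
  have y_f k : B k -> 0 <= pairing (y k) (hat r%:R f).
    move=> Bk; rewrite fE pairing_sumZ sumr_ge0 // => i Ai.
    by rewrite mulr_ge0 // y_ge0.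
  have c_ge k : B k -> 0 <= c k * pairing (y k) (hat r%:R f).
    by move=> Bk; rewrite mulr_ge0 // y_f.
  have : \sum_(k | B k) c k * pairing (y k) (hat r%:R f) = 0.
    by rewrite -cE u'E uf subrr.
  by move=> /(psumr_eq0P c_ge) /(_ j Bj) /eqP; rewrite mulf_eq0 (negbTE cj) => /eqP.
exists (- 1 *: usubmx (y j)); split.
  move=> z1 z2 [_ /= z1I] [_ /= z2I]; rewrite pairingZl -y0E mulN1r rpredN.
  by apply: yI => //; rewrite int_hat rpred0 int_mxB.
move=> f Ff; rewrite -pairingB pairingZl -y0E -(subrr r%:R) -hatB pairingB.
by rewrite yF // ym //; ring.
Qed.

(** * Free joins *)

(** In the Smith normal form U = L D V, the rows of V at nonzero diagonal entries of D form a
    lattice basis of all integral vectors in the span, even when the [u i] generate a smaller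
    lattice. [T'] consists of these rows, and [T] reads off coordinates. *)
Lemma lattice_coordinates (R : realType) (n : nat) (I : finType)
    (u : I -> 'rV[R]_n) :
  (forall i, u i \is a mxOver Num.int) ->
  exists (d : nat) (T : 'M[R]_(n, d)) (T' : 'M[R]_(d, n)),
  [/\ T \is a mxOver Num.int, T' \is a mxOver Num.int, T' *m T = 1%:M,
      (T' <= rowspan predT u)%MS
    & forall v : 'rV[R]_n, (v <= rowspan predT u)%MS -> v *m T *m T' = v].
Proof.
move=> uI; pose U := \matrix_(k < #|I|) u (enum_val k).
have uU : (rowspan predT u <= U)%MS.
  apply: rowspan_subP => i _; have <- : row (enum_rank i) U = u i.
    by rewrite rowK enum_rankK.
  exact: row_sub.
have Uu : (U <= rowspan predT u)%MS.
  by apply/row_subP => k; rewrite rowK; exact: rowspan_sup.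
pose M : 'M[int]_(#|I|, n) := map_mx Num.floor U.
have ME : map_mx intr M = U.
  apply/matrixP => k j; rewrite !mxE floorK //.
  by have /mxOverP := uI (enum_val k); apply.
have [L Lu [V Vu [e _ MLV]]] := int_Smith_normal_form M.
pose D : 'M[R]_(#|I|, n) := \matrix_(i, j) ((e`_i)%:~R *+ (i == j :> nat)).
pose re p q (X : 'M[int]_(p, q)) : 'M[R]_(p, q) := map_mx intr X.
have reI p q (X : 'M[int]_(p, q)) : re _ _ X \is a mxOver Num.int.
  by apply/mxOverP => i j; rewrite mxE intr_int.
have UE : U = re _ _ L *m D *m re _ _ V.
  rewrite -ME MLV !map_mxM; congr (_ *m _ *m _).
  by apply/matrixP => i j; rewrite !mxE raddfMn.
have LK : re _ _ (invmx L) *m re _ _ L = 1%:M by rewrite -map_mxM mulVmx // map_mx1.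
have VK : re _ _ V *m re _ _ (invmx V) = 1%:M by rewrite -map_mxM mulmxV // map_mx1.
pose K : {set 'I_n} := [set j : 'I_n | (j < #|I|)%N && (e`_j != 0)]%SET.
pose S : 'M[R]_(#|K|, n) := \matrix_(k, j) (enum_val k == j)%:R.
have SI : S \is a mxOver Num.int.
  by apply/mxOverP => i j; rewrite mxE natr_int.
have STI : S^T \is a mxOver Num.int.
  by apply/mxOverP => i j; rewrite !mxE natr_int.
have SS : S *m S^T = 1%:M.
  apply/matrixP => k l; rewrite !mxE (bigD1 (enum_val k)) //= big1 => [|j jk].
    by rewrite !mxE eqxx mul1r addr0 (inj_eq enum_val_inj) eq_sym.
  by rewrite !mxE eq_sym (negbTE jk) mul0r.
have DSS : D *m S^T *m S = D.
  have STS l j : (S^T *m S) l j = ((l == j) && (l \in K))%:R.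
    rewrite mxE; have [lK|lK] := boolP (l \in K).
      rewrite (bigD1 (enum_rank_in lK l)) //= big1 => [|k kl].
        by rewrite !mxE enum_rankK_in // eqxx mul1r addr0 andbT.
      rewrite !mxE (_ : (_ == l) = false) ?mul0r //; apply: contraNF kl => /eqP ekl.
      by apply/eqP/enum_val_inj; rewrite enum_rankK_in.
    rewrite andbF big1 // => k _; rewrite !mxE (_ : (_ == l) = false) ?mul0r //.
    by apply: contraNF lK => /eqP <-; exact: enum_valP.
  apply/matrixP => i j; rewrite -mulmxA mxE (bigD1 j) //= STS eqxx.
  rewrite big1 ?addr0 => [|l /negbTE lj]; last by rewrite STS lj mulr0.
  have [jK|] := boolP (j \in K); first by rewrite mulr1.
  rewrite inE negb_and negbK mulr0 mxE => /orP[jI|/eqP ej].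
    by rewrite (_ : (_ == _) = false) //; apply: contraNF jI => /eqP <-.
  by have [->|] := eqVneq (i : nat) j; rewrite ?ej.
(* This inverts the nonzero diagonal entries over the reals, which suffices to put the selected rows
   of V in the row space of [U]. *)
pose C : 'M[R]_(#|K|, #|I|) :=
  \matrix_(k, i) ((i == (enum_val k : 'I_n) :> nat)%:R * ((e`_i)%:~R)^-1).
have CD : C *m D = S.
  apply/matrixP => k j; have := enum_valP k; rewrite inE => /andP[kI ek].
  rewrite !mxE (bigD1 (Ordinal kI)) //= big1 => [|i ik].
    by rewrite !mxE eqxx mul1r addr0 mulrnAr mulVf ?intr_eq0.
  by rewrite !mxE (_ : (_ == _) = false) ?mul0r //; apply: contraNF ik.
exists #|K|, (re _ _ (invmx V) *m S^T), (S *m re _ _ V); split.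
- exact: int_mxM.
- exact: int_mxM.
- by rewrite mulmxA -[_ *m _ *m re _ _ (invmx V)]mulmxA VK mulmx1.
- apply: submx_trans Uu; apply/submxP; exists (C *m re _ _ (invmx L)).
  by rewrite UE -CD !mulmxA -[C *m _ *m re _ _ L]mulmxA LK mulmx1.
move=> v /submx_trans /(_ uU) /submxP[w ->]; rewrite UE !mulmxA.
rewrite -[_ *m re _ _ V *m re _ _ (invmx V)]mulmxA VK mulmx1.
have XDSS (X : 'rV[R]_#|I|) : X *m D *m S^T *m S = X *m D.
  by rewrite -[in RHS]DSS !mulmxA.
by rewrite XDSS.
Qed.

Lemma hat_mul_block (R : realType) (m n : nat) (t : R) (z : 'rV[R]_m)
    (T : 'M[R]_(m, n)) (a : 'rV[R]_n) :
  hat t z *m block_mx T 0 a 1%:M = hat t (z *m T + t *: a).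
Proof.
rewrite /hat mul_row_block mulmx0 add0r mulmx1; congr (row_mx (_ + _) _).
by apply/rowP => i; rewrite !mxE big_ord1 mxE.
Qed.

Lemma lsubmx_hat (R : realType) (n : nat) (t : R) (p : 'rV[R]_n) :
  lsubmx (hat t p) = p.
Proof. exact: row_mxKl. Qed.

Lemma int_block (R : realType) (m n : nat) (T : 'M[R]_(m, n)) (a : 'rV[R]_n) :
  T \is a mxOver Num.int -> a \is a mxOver Num.int ->
  block_mx T 0 a (1%:M : 'M_1) \is a mxOver Num.int.
Proof.
move=> /mxOverP TI /mxOverP aI; apply/mxOverP => i j; rewrite mxE.
case: (fintype.split i) => k; rewrite mxE; case: (fintype.split j) => l;
  by rewrite ?mxE ?rpred0 ?natr_int.
Qed.

(* Phi and Gam are the integral, height-preserving coordinate change between the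
   cone over {p i | A i} and the cone over the full-dimensional polytope conv q. *)
Lemma face_summand (R : realType) (n s : nat) (I J : finType)
    (p : I -> 'rV[R]_n) (y : J -> 'cV[R]_(n + 1)) (A : pred I) (B : pred J)
    (Pi : 'M[R]_(n + 1)) (v : 'rV[R]_n) :
  let x i := hat 1 (p i) in
  (forall i, p i \is a mxOver Num.int) -> (exists i, A i) ->
  (forall i, x i *m Pi = if A i then x i else 0) ->
  (forall j g, (g <= rowspan predT x)%MS -> g \is a mxOver Num.int ->
     pairing (y j) g \is a Num.int) ->
  (forall i j, 0 <= pairing (y j) (x i)) ->
  (forall u, (forall i, 0 <= pairing u (x i)) ->
     exists c : J -> R, (forall j, 0 <= c j) /\
       forall i, pairing u (x i) = \sum_j c j * pairing (y j) (x i)) ->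
  (forall i j, B j != A i -> pairing (y j) (x i) = 0) ->
  (0 < s)%N -> v \is a mxOver Num.int -> (hat s%:R v <= rowspan A x)%MS ->
  (forall j, B j -> pairing (y j) (hat s%:R v) = 1) ->
  exists (d : nat) (Phi : 'M[R]_(n + 1, d + 1)) (Gam : 'M[R]_(d + 1, n + 1))
    (q : I -> 'rV[R]_d),
  [/\ Phi \is a mxOver Num.int /\ Gam \is a mxOver Num.int,
      Gam *m Phi = 1%:M /\ (Gam <= rowspan A x)%MS,
      forall g : 'rV[R]_(n + 1), (g <= rowspan A x)%MS -> g *m Phi *m Gam = g,
      (forall t z, exists z', hat t z *m Phi = hat t z') /\
      (forall t z, exists z', hat t z *m Gam = hat t z')
    & (forall i, A i -> x i *m Phi = hat 1 (q i)) /\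
      (gorenstein (conv_hull (points A q)) /\ has_dim (conv_hull (points A q)) d)].
Proof.
move=> x pI [i0 Ai0] xPi yI y_ge0 cone yAB s_gt0 vI vA yv.
have AE : (rowspan A x <= rowspan predT x)%MS.
  by apply: rowspan_subP => i _; exact: rowspan_sup.
pose u i := if A i then p i - p i0 else 0.
have [|d [T [T' [TI T'I T'T T'u TT']]]] := @lattice_coordinates R n I u.
  by move=> i; rewrite /u; case: ifP => _; rewrite ?int_mxB // mxOver0 // rpred0.
(* The translation sends the base vertex [p i0] to the origin. *)
pose a := - (p i0 *m T).
have aI : a \is a mxOver Num.int.
  by rewrite -[a]sub0r int_mxB ?int_mxM // mxOver0 // rpred0.
pose Phi : 'M[R]_(n + 1, d + 1) := block_mx T 0 a 1%:M.
pose Gam : 'M[R]_(d + 1, n + 1) := block_mx T' 0 (p i0) 1%:M.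
have PhiE t z : hat t z *m Phi = hat t ((z - t *: p i0) *m T).
  by rewrite hat_mul_block mulmxBl -scalemxAl scalerN.
have GamE t z : hat t z *m Gam = hat t (z *m T' + t *: p i0).
  by rewrite hat_mul_block.
have uA z : (z <= rowspan predT u)%MS -> (hat 0 z <= rowspan A x)%MS.
  move=> /rowspanP[c ->].
  have -> : hat 0 (\sum_i c i *: u i) = \sum_i c i *: hat 0 (u i).
    by rewrite hat_sum; congr hat; rewrite big1 // => i _; rewrite mulr0.
  apply: summx_sub => i _; apply: scalemx_sub; rewrite /u; case: ifP => Ai.
    by rewrite -(subrr 1) -hatB addmx_sub ?eqmx_opp ?(@rowspan_sup _ _ _ A x).
  by rewrite hat0 sub0mx.
have Au t z : (hat t z <= rowspan A x)%MS -> (z - t *: p i0 <= rowspan predT u)%MS.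
  move=> /rowspanP[c]; rewrite hat_sum => /hat_inj[-> ->].
  rewrite scaler_suml -sumrB; apply: summx_sub => i Ai.
  have -> : c i *: p i - (c i * 1) *: p i0 = c i *: u i.
    by rewrite mulr1 -scalerBr /u Ai.
  by apply: scalemx_sub; exact: rowspan_sup.
have GamPhi : Gam *m Phi = 1%:M.
  apply/row_matrixP => k; rewrite rowE row1 mulmxA.
  by rewrite [delta_mx 0 k]hatE GamE PhiE addrK -mulmxA T'T mulmx1.
have GamA : (Gam <= rowspan A x)%MS.
  apply/row_subP => k; rewrite rowE [delta_mx 0 k]hatE GamE.
  move: (rsubmx _ 0 0) (lsubmx _) => t z.
  have -> : hat t (z *m T' + t *: p i0) = hat 0 (z *m T') + t *: x i0.
    by rewrite hatZ hatD add0r mulr1.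
  rewrite addmx_sub //; first by apply: uA; apply: submx_trans (submxMl _ _) T'u.
  by rewrite scalemx_sub // (@rowspan_sup _ _ _ A x).
have PhiGam (g : 'rV[R]_(n + 1)) : (g <= rowspan A x)%MS -> g *m Phi *m Gam = g.
  by rewrite [g]hatE => /Au gu; rewrite PhiE GamE TT' // subrK.
pose q i := (p i - p i0) *m T.
have xPhi i : x i *m Phi = hat 1 (q i) by rewrite PhiE scale1r.
exists d, Phi, Gam, q; split=> //.
- by rewrite !int_block.
- by split=> t z; [rewrite PhiE|rewrite GamE]; eexists.
split; first by move=> i _; exact: xPhi.
have GamAw (w : 'rV[R]_(d + 1)) : (w *m Gam <= rowspan A x)%MS.
  exact: submx_trans (submxMl _ _) GamA.
have yB i j : A i -> B j = false -> pairing (y j) (x i) = 0.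
  by move=> Ai Bj; apply: yAB; rewrite Ai Bj.
apply: (@gorenstein_criterion _ _ s I J A B q (fun j => Gam *m y j)
  ((v - s%:R *: p i0) *m T)) => //.
- by exists i0.
- by move=> i Ai; rewrite int_mxM ?int_mxB.
- have full : (1%:M <= rowspan A (fun i => hat 1 (q i)))%MS.
    apply/rV_subP => w _; rewrite -[w]mulmx1 -GamPhi mulmxA.
    have /rowspanP[c ->] := GamAw w; rewrite mulmx_suml.
    apply: summx_sub => i Ai; rewrite -scalemxAl xPhi scalemx_sub //.
    exact: (@rowspan_sup _ _ _ A (fun i => hat 1 (q i))).
  have := mxrankS full; rewrite mxrank1.
  have := rank_leq_row (rowspan A (fun i => hat 1 (q i))); lia.
- by rewrite int_mxM ?int_mxB ?int_mxZ ?natr_int.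
- move=> j g Bj gI; rewrite -pairing_mulmx; apply: yI; last by rewrite int_mxM ?int_block.
  exact: submx_trans AE.
- by move=> j Bj; rewrite -pairing_mulmx -PhiE PhiGam // yv.
(* Pulled back through [Pi], a functional on the factor vanishes on the other vertices, so it is
   nonnegative on the whole cone and expands in the [y j]; those outside [B] vanish over [A]. *)
- move=> f f_ge0; have [i|c [c_ge0 cE]] := cone (Pi *m Phi *m f).
    rewrite -!pairing_mulmx mulmxA xPi; case: ifP => Ai; first by rewrite xPhi f_ge0.
    by rewrite mul0mx pairing0.
  exists c; split=> // w.
  have /rowspanP[b bE] := GamAw w.
  rewrite -[in LHS](mulmx1 w) -GamPhi mulmxA bE mulmx_suml.
  under eq_bigr do rewrite -scalemxAl.
  rewrite pairing_sumZ.
  under [RHS]eq_bigr do rewrite -pairing_mulmx bE pairing_sumZ mulr_sumr.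
  rewrite exchange_big; apply: eq_bigr => i Ai; under [RHS]eq_bigr do rewrite mulrCA.
  rewrite -mulr_sumr; congr (_ * _).
  have := cE i; rewrite -!pairing_mulmx mulmxA xPi Ai => ->.
  rewrite (bigID B) /= [X in _ + X]big1 ?addr0 // => j /negbTE Bj.
  by rewrite yB ?mulr0.
move=> i j Ai Bj; rewrite -pairing_mulmx -xPhi PhiGam //.
exact: (@rowspan_sup _ _ _ A x).
Qed.

Lemma conv_hull_sub (R : realType) (n : nat) (I : finType) (A : pred I)
    (p : I -> 'rV[R]_n) (B : set 'rV[R]_n) :
  B `<=` conv_hull (points A p) -> conv_hull B `<=` conv_hull (points A p).
Proof.
move=> BA x [k [c [q [qB c_ge0 c1 ->]]]].
have /choice[a ha] : forall i, exists a : I -> R, (forall l, 0 <= a l) /\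
    hat 1 (q i) = \sum_(l | A l) a l *: hat 1 (p l).
  by move=> i; apply/conv_hull_points/BA.
apply/conv_hull_points; exists (fun l => \sum_i c i * a i l); split.
  by move=> l; rewrite sumr_ge0 // => i _; rewrite mulr_ge0 //; have [] := ha i.
transitivity (\sum_i c i *: hat 1 (q i)).
  by rewrite hat_sum; under [in RHS]eq_bigr do rewrite mulr1; rewrite c1.
under eq_bigr => i _ do rewrite (ha i).2 scaler_sumr.
rewrite exchange_big; apply: eq_bigr => l _; rewrite scaler_suml.
by apply: eq_bigr => i _; rewrite scalerA.
Qed.

Lemma conv_hull_mulmx (R : realType) (m n : nat) (I : finType) (A : pred I)
    (p : I -> 'rV[R]_m) (M : 'M[R]_(m + 1, n)) (x : 'rV[R]_m) :
  conv_hull (points A p) x ->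
  conv_hull (points A (fun i => hat 1 (p i) *m M)) (hat 1 x *m M).
Proof.
move=> /conv_hull_points[c [c_ge0 xE]]; apply/conv_hull_points; exists c; split=> //.
have := xE; rewrite !hat_sum => /hat_inj[c1 _]; rewrite -c1; congr hat.
by rewrite xE mulmx_suml; apply: eq_bigr => i _; rewrite scalemxAl.
Qed.

(** Both embeddings are linear on the cones over the factors: the height of the left factor is
    forgotten, that of the right one becomes the last coordinate of the join. *)
Definition join_left (R : realType) (m n : nat) : 'M[R]_(m + 1, m + n + 1) :=
  row_mx (row_mx (lsubmx 1%:M) 0) 0.

Definition join_right (R : realType) (m n : nat) : 'M[R]_(n + 1, m + n + 1) :=
  row_mx (row_mx 0 (lsubmx 1%:M)) (rsubmx 1%:M).

Lemma join_leftE (R : realType) (m n : nat) (t : R) (x : 'rV[R]_m) :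
  hat t x *m join_left R m n = row_mx (row_mx x 0) 0.
Proof.
by rewrite !mul_mx_row !mulmx0 mulmx_lsub mulmx1 lsubmx_hat.
Qed.

Lemma join_rightE (R : realType) (m n : nat) (t : R) (y : 'rV[R]_n) :
  hat t y *m join_right R m n = row_mx (row_mx 0 y) (const_mx t).
Proof.
rewrite !mul_mx_row !mulmx0 mulmx_lsub mulmx_rsub !mulmx1 lsubmx_hat.
by rewrite /hat row_mxKr.
Qed.

Lemma int_join (R : realType) (m n : nat) :
  (join_left R m n \is a mxOver Num.int) * (join_right R m n \is a mxOver Num.int).
Proof.
split; apply/mxOverP => i j; rewrite mxE; case: (fintype.split j) => k; rewrite mxE;
  try (case: (fintype.split k) => l; rewrite mxE); rewrite ?mxE ?rpred0 ?natr_int //.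
Qed.

Lemma free_join_points (R : realType) (m n : nat) (I : finType) (A : pred I)
    (q1 : I -> 'rV[R]_m) (q2 : I -> 'rV[R]_n) :
  free_join (conv_hull (points A q1)) (conv_hull (points (predC A) q2)) =
  conv_hull (points predT (fun i =>
    if A i then hat 1 (q1 i) *m join_left R m n else hat 1 (q2 i) *m join_right R m n)).
Proof.
set f := fun i => _; apply/seteqP; split.
  apply: conv_hull_sub => _ [] [x xQ <-].
    rewrite -(join_leftE n 1 x).
    have := conv_hull_mulmx (join_left R m n) xQ.
    by apply: conv_hullS => _ [i Ai ->]; exists i; rewrite /f ?Ai.
  rewrite -(join_rightE m 1 x).
  have := conv_hull_mulmx (join_right R m n) xQ.
  by apply: conv_hullS => _ [i Ai ->]; exists i; rewrite /f ?(negbTE Ai).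
apply: conv_hullS => _ [i _ ->]; rewrite /f; have [Ai|Ai] := boolP (A i).
  left; exists (q1 i); last by rewrite join_leftE.
  by apply: sub_conv_hull; exists i.
right; exists (q2 i); last by rewrite join_rightE.
by apply: sub_conv_hull; exists i.
Qed.

(** By minimality a point has index at most 1, which contradicts the bound on [r]; this settles
    dimension zero. *)
Lemma reflexive_point (R : realType) (n : nat) (P : set 'rV[R]_n) :
  lattice_polytope P -> has_dim P 0 -> reflexive_polytope (dilate 1 P).
Proof.
move=> latP dimP; have -> : dilate 1 P = P.
  apply/seteqP; split=> [_ [x Px <-]|x Px]; first by rewrite scale1r.
  by exists x => //; rewrite scale1r.
split=> //; have [k [p [PE pI]]] := lattice_polytope_points latP.
have [_ [m Pm] _] := latP; exists m.
have [x0 [U [/eqP U0 aff]]] := dimP; rewrite dimv_eq0 in U0.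
have affE z : aff_hull P z -> z = x0.
  by rewrite aff (eqP U0) /= memv0 subr_eq0 => /eqP.
have subA z : P z -> z = x0.
  move=> Pz; apply: affE; exists 1%N, (fun=> 1), (fun=> z); split=> //.
    by rewrite big_ord1.
  by rewrite big_ord1 scale1r.
have mx0 := subA m Pm; split.
- split=> //; apply/near_normP; exists 1 => // z _ /affE ->.
  by rewrite -mx0.
- move: Pm; rewrite PE => /conv_hull_points[c [_]]; rewrite hat_sum => /hat_inj[c1 _].
  have [i _] : exists i : 'I_k, True.
    apply: contrapT => no; have /eqP := c1; rewrite big1 ?oner_eq0 // => i _.
    by case: no; exists i.
  have Pi : P (p i) by rewrite PE; apply: sub_conv_hull; exists i.
  by rewrite mx0 -(subA _ Pi).
move=> F [_ [d [dP _]]]; exfalso; move: dimP dP.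
by rewrite PE => /has_dim_rank e0 /has_dim_rank; rewrite e0.
Qed.

(** * The lattice isomorphism onto a free join of two factors *)

Theorem theorem1p1 (R : realType) (N d r : nat) (P : set 'rV[R]_N)
    (hdim : has_dim P d)
    (hgor : gorenstein P)
    (hindex : gorenstein_index P r)
    (hr : (d%:R + 2) / 2 < r%:R :> R) :
  exists (k : nat) (n : nat -> nat) (Q : forall i : nat, set 'rV[R]_(n i)),
    [/\ (0 < k)%N,
        forall i : nat, (i <= k)%N -> gorenstein (Q i) /\ has_dim (Q i) (n i)
      & lattice_isomorphic P (iter_free_join Q k)].
Proof.
have [latP _] := hgor; have [r_gt0 refl minr] := hindex.
have {hr} rd : (d + 2 < 2 * r)%N.
  by rewrite -(ltr_nat R) natrD natrM mulrC -ltr_pdivrMr.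
case: d => [|d] in hdim rd.
  by have := minr 1%N isT (reflexive_point latP hdim); lia.
have [k [p [PE pI]]] := lattice_polytope_points latP.
rewrite PE in hdim refl *.
have [J [y [al [m [mI [al_gt0 mE] yI [y_ge0 ym] cone]]]]] :=
  reflexive_cone_data r_gt0 pI hdim refl.
have /has_dim_rank rE := hdim.
set x := fun i => hat 1 (p i) in mE yI y_ge0 cone rE.
pose E := rowspan predT x.
have xI i : x i \is a mxOver Num.int by rewrite int_hat rpred1 pI.
have hx i : pairing (height R N) (x i) = 1 by rewrite pairing_height.
have alr : \sum_i al i = r%:R.
  have := congr1 (pairing (height R N)) mE; rewrite pairing_height pairing_sumZ => ->.
  by apply: eq_bigr => i _; rewrite hx mulr1.
have aly j : \sum_i al i * pairing (y j) (x i) = 1.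
  by rewrite -pairing_sumZ -mE ym.
have [|A [B [s [[Ane nAne] yAB als alsI splitM]]]] :=
  gorenstein_cone_splits xI yI y_ge0 hx cone al_gt0 alr aly rE.
  by move: rd; lia.
have als' : \sum_(i | ~~ A i) al i = r%:R - s%:R.
  by have := alr; rewrite (bigID A) /= als => <-; rewrite addrAC subrr add0r.
have sum_gt0 (C : pred 'I_k) : (exists i, C i) -> 0 < \sum_(i | C i) al i.
  move=> [i Ci]; rewrite (bigD1 i) //= ltr_pwDl // sumr_ge0 // => l _.
  exact: ltW.
have s_gt0 : (0 < s)%N by rewrite -(ltr_nat R) -als sum_gt0.
have sr : (s < r)%N by rewrite -(ltr_nat R) -subr_gt0 -als' sum_gt0.
(* The components of [m] at heights [s] and [r - s] serve as interior lattice points of the dilated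
   factors, whose heights add up to [r]. *)
pose v1 := \sum_(i | A i) al i *: p i; pose v2 := \sum_(i | ~~ A i) al i *: p i.
have v1E : hat s%:R v1 = \sum_(i | A i) al i *: x i.
  by rewrite hat_sum -als; under [in RHS]eq_bigr do rewrite mulr1.
have v2E : hat (r - s)%:R v2 = \sum_(i | ~~ A i) al i *: x i.
  by rewrite hat_sum natrB ?(ltnW sr) // -als'; under [in RHS]eq_bigr do rewrite mulr1.
have v1I : v1 \is a mxOver Num.int by move: alsI; rewrite -v1E int_hat => /andP[].
have v2I : v2 \is a mxOver Num.int.
  have : hat r%:R m = hat s%:R v1 + hat (r - s)%:R v2.
    by rewrite mE (bigID A) v1E v2E.
  by rewrite hatD => /hat_inj[_ mv]; rewrite -[v2](addKr v1) -mv addrC int_mxB.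
pose E1 := rowspan A x; pose E2 := rowspan (predC A) x.
have v1A : (hat s%:R v1 <= E1)%MS by rewrite v1E; apply/rowspanP; exists al.
have v2A : (hat (r - s)%:R v2 <= E2)%MS by rewrite v2E; apply/rowspanP; exists al.
have EE : (E <= E1 + E2)%MS.
  apply: rowspan_subP => i _; have [Ai|Ai] := boolP (A i).
    by apply: submx_trans (addsmxSl _ _); exact: (@rowspan_sup _ _ _ A x).
  by apply: submx_trans (addsmxSr _ _); exact: (@rowspan_sup _ _ _ (predC A) x).
have E1E : (E1 <= E)%MS by apply: rowspan_subP => i _; exact: rowspan_sup.
have E2E : (E2 <= E)%MS by apply: rowspan_subP => i _; exact: rowspan_sup.
have yE1 j v : ~~ B j -> (v <= E1)%MS -> pairing (y j) v = 0.
  by move=> Bj; apply: pairing_rowspan => i Ai; rewrite yAB // Ai (negbTE Bj).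
have yE2 j v : B j -> (v <= E2)%MS -> pairing (y j) v = 0.
  by move=> Bj; apply: pairing_rowspan => i /= Ai; rewrite yAB // Bj (negbTE Ai).
(* Facets in [B] vanish on [E2] and the others on [E1], so all of them kill a common vector. *)
have E12 : (E1 :&: E2 = 0)%MS.
  apply/eqP; rewrite -submx0; apply/rV_subP => v; rewrite sub_capmx => /andP[vE1 vE2].
  suff -> : v = 0 by exact: sub0mx.
  apply: (facets_separate hx cone) => [|j]; first exact: submx_trans E1E.
  by have [Bj|Bj] := boolP (B j); [exact: yE2|exact: yE1].
have E21 : (E2 :&: E1 = 0)%MS by rewrite capmxC.
have [Pi1 [Pi11 Pi12 Pi1S]] : exists M : 'M[R]_(N + 1),
    [/\ forall v : 'rV[R]_(N + 1), (v <= E1)%MS -> v *m M = v,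
      forall v : 'rV[R]_(N + 1), (v <= E2)%MS -> v *m M = 0
    & forall v : 'rV[R]_(N + 1), (v *m M <= E1)%MS].
  exists (proj_mx E1 E2); split=> v; [exact: proj_mx_id|exact: proj_mx_0|].
  exact: proj_mx_sub.
have [Pi2 [Pi22 Pi21 Pi2S]] : exists M : 'M[R]_(N + 1),
    [/\ forall v : 'rV[R]_(N + 1), (v <= E2)%MS -> v *m M = v,
      forall v : 'rV[R]_(N + 1), (v <= E1)%MS -> v *m M = 0
    & forall v : 'rV[R]_(N + 1), (v *m M <= E2)%MS].
  exists (proj_mx E2 E1); split=> v; [exact: proj_mx_id|exact: proj_mx_0|].
  exact: proj_mx_sub.
have Pi12E (v : 'rV[R]_(N + 1)) : (v <= E)%MS -> v *m Pi1 + v *m Pi2 = v.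
  move=> /submx_trans /(_ EE) /sub_addsmxP[[a b] /= ->].
  rewrite !mulmxDl (Pi11 _ (submxMl a E1)) (Pi12 _ (submxMl b E2)).
  by rewrite (Pi21 _ (submxMl a E1)) (Pi22 _ (submxMl b E2)) addr0 add0r.
have xPi1 i : x i *m Pi1 = if A i then x i else 0.
  case: ifPn => Ai; first by rewrite Pi11 //; exact: (@rowspan_sup _ _ _ A x).
  by rewrite Pi12 //; exact: (@rowspan_sup _ _ _ (predC A) x).
have xPi2 i : x i *m Pi2 = if predC A i then x i else 0.
  rewrite /=; case: (boolP (A i)) => Ai /=.
    by rewrite Pi21 //; exact: (@rowspan_sup _ _ _ A x).
  by rewrite Pi22 //; exact: (@rowspan_sup _ _ _ (predC A) x).
have yv1 j : B j -> pairing (y j) (hat s%:R v1) = 1.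
  move=> Bj; rewrite -[RHS](ym j) mE (bigID A) /= -v1E -v2E pairingD.
  by rewrite (yE2 j _ Bj v2A) addr0.
have yv2 j : predC B j -> pairing (y j) (hat (r - s)%:R v2) = 1.
  move=> Bj; rewrite -[RHS](ym j) mE (bigID A) /= -v1E -v2E pairingD.
  by rewrite (yE1 j _ Bj v1A) add0r.
have [d1 [Phi1 [Gam1 [q1 [[Phi1I Gam1I] [GP1 Gam1E] PG1 [Phi1h Gam1h] [xq1 gor1]]]]]] :=
  face_summand pI Ane xPi1 yI y_ge0 cone yAB s_gt0 v1I v1A yv1.
have yAB' i j : predC B j != predC A i -> pairing (y j) (x i) = 0.
  by rewrite /= (inj_eq negb_inj); exact: yAB.
have rs_gt0 : (0 < r - s)%N by rewrite subn_gt0.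
have [d2 [Phi2 [Gam2 [q2 [[Phi2I Gam2I] [GP2 Gam2E] PG2 [Phi2h Gam2h] [xq2 gor2]]]]]] :=
  face_summand pI nAne xPi2 yI y_ge0 cone yAB' rs_gt0 v2I v2A yv2.
pose n i := if i is 0%N then d1 else d2.
pose Q i : set 'rV[R]_(n i) := match i return set 'rV[R]_(n i) with
  | 0%N => conv_hull (points A q1) | _.+1 => conv_hull (points (predC A) q2) end.
exists 1%N, n, Q; split=> //; first by case=> [|[|i]].
rewrite /iter_free_join /= free_join_points.
pose Psi := Pi1 *m Phi1 *m join_left R d1 d2 + Pi2 *m Phi2 *m join_right R d1 d2.
pose f (z : 'rV[R]_N) := hat 1 z *m Psi.
have joinE t1 t2 (a : 'rV[R]_d1) (b : 'rV[R]_d2) :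
    hat t1 a *m join_left R d1 d2 + hat t2 b *m join_right R d1 d2 =
    row_mx (row_mx a b) (const_mx t2).
  by rewrite join_leftE join_rightE !add_row_mx !add0r addr0.
have fp : (fun i => if A i then hat 1 (q1 i) *m join_left R d1 d2
    else hat 1 (q2 i) *m join_right R d1 d2) = f \o p.
  apply/funext => i; rewrite /= (_ : f (p i) = x i *m Psi) //.
  rewrite /Psi mulmxDr !mulmxA xPi1 xPi2 /=.
  by case: ifPn => Ai; rewrite /= !mul0mx ?addr0 ?add0r ?xq1 ?xq2.
rewrite fp.
(* The two components of a point at height 1 have heights 1 - t and t. The join stores only t, and 1
   - t is recovered from it. *)
pose inv (w : 'rV[R]_(d1 + d2 + 1)) : 'rV[R]_(N + 1) :=
  hat (1 - rsubmx w 0 0) (lsubmx (lsubmx w)) *m Gam1 +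
  hat (rsubmx w 0 0) (rsubmx (lsubmx w)) *m Gam2.
have fK z : (hat 1 z <= E)%MS -> inv (f z) = hat 1 z.
  move=> zE; pose e1 := hat 1 z *m Pi1; pose e2 := hat 1 z *m Pi2.
  have e12 : e1 + e2 = hat 1 z by exact: Pi12E.
  have e1E : (e1 <= E1)%MS by exact: Pi1S.
  have e2E : (e2 <= E2)%MS by exact: Pi2S.
  have := e12; rewrite [e1]hatE [e2]hatE hatD => /hat_inj[t12 _].
  have [a aE] := Phi1h (rsubmx e1 0 0) (lsubmx e1); rewrite -hatE in aE.
  have [b bE] := Phi2h (rsubmx e2 0 0) (lsubmx e2); rewrite -hatE in bE.
  have -> : f z = row_mx (row_mx a b) (const_mx (rsubmx e2 0 0)).
    by rewrite -(joinE (rsubmx e1 0 0)) -aE -bE /f /Psi mulmxDr !mulmxA.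
  rewrite /inv !row_mxKl !row_mxKr mxE -[X in hat (X - _) _]t12 addrK.
  by rewrite -aE -bE PG1 // PG2.
have f_onto w : exists z, [/\ (hat 1 z <= E)%MS, f z = w
    & w \is a mxOver Num.int -> z \is a mxOver Num.int].
  pose t := rsubmx w 0 0.
  pose w1 := lsubmx (lsubmx w).
  pose w2 := rsubmx (lsubmx w).
  have wE : w = row_mx (row_mx w1 w2) (const_mx t).
    by rewrite hsubmxK [LHS]hatE.
  have [a' aE] := Gam1h (1 - t) w1; have [b' bE] := Gam2h t w2.
  have a'E : (hat (1 - t) a' <= E1)%MS.
    by rewrite -aE; exact: submx_trans (submxMl _ _) Gam1E.
  have b'E : (hat t b' <= E2)%MS.
    by rewrite -bE; exact: submx_trans (submxMl _ _) Gam2E.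
  have zE : hat 1 (a' + b') = hat (1 - t) a' + hat t b' by rewrite hatD subrK.
  exists (a' + b'); split.
  - by rewrite zE addmx_sub ?(submx_trans a'E) ?(submx_trans b'E).
  - rewrite /f zE /Psi mulmxDr !mulmxA !mulmxDl.
    rewrite (Pi11 _ a'E) (Pi12 _ b'E) (Pi21 _ a'E) (Pi22 _ b'E).
    rewrite !mul0mx addr0 add0r -aE -bE -[_ *m Gam1 *m _]mulmxA GP1.
    by rewrite -[_ *m Gam2 *m _]mulmxA GP2 !mulmx1 joinE.
  move=> wI; have /mxOverP wIe := wI.
  have tI : t \is a Num.int by rewrite /t mxE.
  have aI : w1 \is a mxOver Num.int by apply/mxOverP => i j; rewrite !mxE.
  have bI : w2 \is a mxOver Num.int by apply/mxOverP => i j; rewrite !mxE.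
  have : hat 1 (a' + b') \is a mxOver Num.int.
    by rewrite zE -aE -bE int_mxD // int_mxM // int_hat ?aI ?bI ?tI ?rpredB ?rpred1.
  by rewrite int_hat => /andP[].
have affP z : aff_hull (conv_hull (points predT p)) z <-> (hat 1 z <= E)%MS.
  exact: aff_hull_conv.
have f_comb (c : 'I_k -> R) z : hat 1 z = \sum_i c i *: x i ->
    hat 1 (f z) = \sum_i c i *: hat 1 (f (p i)).
  move=> zE; have := zE; rewrite /x hat_sum => /hat_inj[c1 _].
  rewrite hat_sum -c1; congr hat; rewrite /f zE mulmx_suml.
  by apply: eq_bigr => i _; rewrite scalemxAl.
(* Every point of the ambient space is the image of a point of the affine hull of [P], so the join
   is full-dimensional. *)
have affQ w : aff_hull (conv_hull (points predT (f \o p))) w.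
  apply/aff_hull_conv; have [z [/rowspanP[c zE] <- _]] := f_onto w.
  by rewrite (f_comb c z zE); apply/rowspanP; exists c.
exists f; split.
- move=> z1 z2 t _ _; rewrite /f !scalemxAl -mulmxDl; congr (_ *m _).
  by rewrite !hatZ hatD !mulr1; congr hat; rewrite addrC subrK.
- split.
  + by move=> z _; exact: affQ.
  + move=> z1 z2; rewrite !inE => /affP z1E /affP z2E f12.
    by have := fK z1 z1E; rewrite f12 (fK z2 z2E) => /hat_inj[_ ->].
  + by move=> w _; have [z [zE fz _]] := f_onto w; exists z => //; exact/affP.
- apply/seteqP; split=> [_ [z /conv_hull_points[c [c_ge0 zE]] <-]|w].
    by apply/conv_hull_points; exists c; split=> //; exact: f_comb.
  move=> /conv_hull_points[c [c_ge0]]; rewrite hat_sum => /hat_inj[c1 wE].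
  have zE : hat 1 (\sum_i c i *: p i) = \sum_i c i *: x i by rewrite hat_sum -c1.
  exists (\sum_i c i *: p i); first by apply/conv_hull_points; exists c.
  have := f_comb c _ zE; rewrite hat_sum => /hat_inj[_ ->].
  by rewrite wE.
apply/seteqP; split=> [_ [z [/affP zE /= zI] <-]|w [_ /= wI]].
  split; first exact: affQ.
  (* The splitting of the lattice enters here: integral coordinates in the join require both
     components of a lattice point to be integral. *)
  have [|g1 [g2 [gE g1E g2E g1I g2I]]] := splitM _ zE; first by rewrite int_hat rpred1.
  rewrite /= /f gE /Psi mulmxDr !mulmxA !mulmxDl.
  rewrite (Pi11 _ g1E) (Pi12 _ g2E) (Pi21 _ g1E) (Pi22 _ g2E).
  rewrite !mul0mx addr0 add0r int_mxD // int_mxM ?int_mxM ?int_join //.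
have [z [zE fz zI]] := f_onto w; exists z => //; split; last exact: zI.
exact/affP.
Qed.
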